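(* Let $\alpha>1$. Let $\mathcal{A}$ be an infinite set with a height function, let $\mathcal{A}(N)$ be the finite set of its elements of height at most $N$, and assume $\log|\mathcal{A}(N)|\asymp\log N$. For each prime $p$ let $f_p:\mathcal{A}\to\{-1,0,1\}$. Suppose there exist $\xi>0$ and multiplicative functions $\eta_+,\eta_-$ with values in $[0,1]$ such that for every pair of coprime positive squarefree integers $q_-,q_+$ with $q_-q_+\le N^{\xi/2}$, $$\frac{1}{|\mathcal{A}(N)|}\left|\left\{x\in\mathcal{A}(N): p\mid q_-\Rightarrow f_p(x)=-1,\ p\mid q_+\Rightarrow f_p(x)=1\right\}\right|=\eta_-(q_-)\eta_+(q_+)+O(N^{-\xi}).$$ Assume further there are constants $c_+,c_-,C>0$ and $M_+,M_-$ such that, uniformly for all $N\ge2$: $\eta_\pm(p)\ll 1/p$ for all primes $p$; $\sum_{p\le N}\eta_\pm(p)=c_\pm\log\log N+M_\pm+O(1/\log N)$; and $\max_{x\in\mathcal{A}(N)}\prod_{p:\,f_p(x)\ne0}p\ll N^C$. Then $$|\mathcal{A}(N)|(\log N)^{(\alpha-1)c_+-(1-\alpha^{-1})c_-}\ll\sum_{x\in\mathcal{A}(N)}\prod_p\alpha^{f_p(x)}\ll|\mathcal{A}(N)|(\log N)^{(\alpha-1)c_+},$$ where the implied constants depend only on $\xi,c_\pm,M_\pm,C,\alpha$ and the implied constants in the assumptions. *)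

(* Defs.v *)
From HB Require Import structures.
From mathcomp Require Import all_boot all_order all_algebra.
From mathcomp Require Import all_classical all_reals all_analysis.
Set Implicit Arguments. Unset Strict Implicit. Unset Printing Implicit Defensive.
Import Order.TTheory GRing.Theory Num.Theory.
Import numFieldNormedType.Exports.
Local Open Scope ring_scope.

Definition squarefree (q : nat) : bool :=
  (0 < q)%N && all (fun p => logn p q <= 1)%N (primes q).

Definition mult01 {R : realType} (eta : nat -> R) : Prop :=
  eta 1%N = 1 /\
  (forall m n : nat, (0 < m)%N -> (0 < n)%N -> coprime m n ->
     eta (m * n)%N = eta m * eta n) /\
  (forall n : nat, (0 < n)%N -> 0 <= eta n <= 1).

Definition count_sign {A : eqType} (AN : seq A) (f : nat -> A -> int)
    (qm qp : nat) : nat :=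
  size [seq x <- AN | all (fun p => f p x == -1) (primes qm)
                   && all (fun p => f p x == 1) (primes qp)].

Definition sum_primes_le {R : realType} (N : R) (g : nat -> R) : R :=
  \sum_(p < (Num.truncn N).+1 | prime p) g p.

Definition partial_weight {R : realType} {A : Type} (alpha : R)
    (f : nat -> A -> int) (x : A) (n : nat) : R :=
  \prod_(p < n | prime p) alpha ^ (f p x).

(* the product over all primes  prod_p alpha^{f_p(x)},  defined as the limit
   of the partial products (these are eventually constant when f_.(x) has
   finite support, which the hypotheses guarantee) *)
Definition euler_weight {R : realType} {A : Type} (alpha : R)
    (f : nat -> A -> int) (x : A) : R :=
  limn (partial_weight alpha f x).

Definition partial_supp_prod {R : realType} {A : Type}
    (f : nat -> A -> int) (x : A) (n : nat) : R :=
  \prod_(p < n | prime p && (f p x != 0)) (p%:R : R).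

(* Main.v *)
Require Import Defs.
From mathcomp Require Import all_boot all_order all_algebra.
From mathcomp Require Import all_classical all_reals all_analysis.
From mathcomp Require Import ring lra zify.
Set Implicit Arguments.
Unset Strict Implicit.
Unset Printing Implicit Defensive.
Import Order.TTheory GRing.Theory Num.Theory.
Import numFieldNormedType.Exports.
Local Open Scope ring_scope.
Local Open Scope classical_set_scope.

(** For [f_p(x)] in [{-1, 0, 1}], the factor [alpha^(f_p)] equals
    [(1 + (alpha - 1) [f_p = 1]) (1 - (1 - 1/alpha) [f_p = -1])].

    Upper bound.  Drop the second factor.  Let [S] be the set of primes with
    [f_p(x) = 1], and [a] the longest initial segment of [S] whose product is at most
    [N^(2d)].  If the next prime exceeds [N^d], only boundedly many primes of [S] lie
    outside [a], and expanding [alpha^|a|] over the subsets of [a] only involves moduli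
    at most [N^(2d)].  Otherwise the next prime lies at a dyadic scale
    [z = N^(d/2^j)]; then [a] is a product of primes up to [z] exceeding [N^d], and
    Rankin's trick with the weight [p^(K/log z)] gains [exp(-K 2^j)], which beats the
    loss [alpha^(O(2^j))] from the primes outside [a], while the weight changes the
    Euler product over [p <= z] by a bounded factor only.

    Lower bound.  Keep the primes up to [N^eps]; the others cost a bounded factor.
    Truncate the expansion of the first factors to divisors at most [N^(xi/8)]; Rankin's
    trick shows that half of the Euler product survives.  For each such divisor, bound
    the product of the second factors from below by the Brun-Hooley sieve: split
    the primes into the layers [(N^(eps/2^(j+1)), N^(eps/2^j)]], truncate each layer at
    an even level growing with [j] by Bonferroni, and telescope the products. *)

Section ConstBigops.
Context {I : Type}.
Implicit Types (s : seq I) (P : pred I).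

Lemma sumr_const_seq {V : nmodType} s P (x : V) :
  \sum_(i <- s | P i) x = x *+ count P s.
Proof. by rewrite big_const_seq iter_addr_0. Qed.

Lemma prodr_const_seq {R : pzSemiRingType} s P (x : R) :
  \prod_(i <- s | P i) x = x ^+ count P s.
Proof. by rewrite big_const_seq iter_mulr_1. Qed.

End ConstBigops.

Section SeqBounds.
Context {R : numDomainType} {I : eqType}.
Implicit Types (s : seq I) (P Q : pred I) (F G : I -> R).

Lemma ler_sum_seq s P F G :
  (forall i, i \in s -> P i -> F i <= G i) ->
  \sum_(i <- s | P i) F i <= \sum_(i <- s | P i) G i.
Proof.
move=> leFG; rewrite big_seq_cond [leRHS]big_seq_cond.
by apply: ler_sum => i /andP[]; apply: leFG.
Qed.

Lemma sumr_ge0_seq s P F :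
  (forall i, i \in s -> P i -> 0 <= F i) -> 0 <= \sum_(i <- s | P i) F i.
Proof.
by move=> F0; rewrite big_seq_cond; apply: sumr_ge0 => i /andP[]; apply: F0.
Qed.

Lemma ler_sum_seq_sub s P Q F :
  (forall i, i \in s -> P i -> Q i) ->
  (forall i, i \in s -> Q i -> 0 <= F i) ->
  \sum_(i <- s | P i) F i <= \sum_(i <- s | Q i) F i.
Proof.
move=> subPQ F0; rewrite big_mkcond [leRHS]big_mkcond; apply: ler_sum_seq => i si _.
have := subPQ i si; have := F0 i si.
by case: (P i) => [F0i /(_ isT) ->//|]; case: (Q i) => [/(_ isT)|].
Qed.

Lemma ler_prod_seq s P F G :
  (forall i, i \in s -> P i -> 0 <= F i <= G i) ->
  \prod_(i <- s | P i) F i <= \prod_(i <- s | P i) G i.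
Proof.
move=> leFG; rewrite big_seq_cond [leRHS]big_seq_cond.
by apply: ler_prod => i /andP[]; apply: leFG.
Qed.

Lemma prodr_ge0_seq s P F :
  (forall i, i \in s -> P i -> 0 <= F i) -> 0 <= \prod_(i <- s | P i) F i.
Proof.
by move=> F0; rewrite big_seq_cond; apply: prodr_ge0 => i /andP[]; apply: F0.
Qed.

Lemma prodr_le1_seq s P F :
  (forall i, i \in s -> P i -> 0 <= F i <= 1) -> \prod_(i <- s | P i) F i <= 1.
Proof.
by move=> F01; rewrite big_seq_cond; apply: prodr_ile1 => i /andP[]; apply: F01.
Qed.

Lemma prodr_ge1_seq s P F :
  (forall i, i \in s -> P i -> 1 <= F i) -> 1 <= \prod_(i <- s | P i) F i.
Proof.
move=> F1; rewrite -[leLHS](@big1 R 1 *%R I s P (fun=> 1)) //.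
by apply: ler_prod_seq => i si Pi; rewrite ler01 F1.
Qed.

Lemma ler_sum_subseq s s' P F : subseq s s' ->
  (forall i, i \in s' -> P i -> 0 <= F i) ->
  \sum_(i <- s | P i) F i <= \sum_(i <- s' | P i) F i.
Proof.
move=> /perm_to_subseq[t perm_s'] F0; rewrite (perm_big _ perm_s') big_cat lerDl.
by apply: sumr_ge0_seq => i ti; apply: F0; rewrite (perm_mem perm_s') mem_cat ti orbT.
Qed.

End SeqBounds.

Section ExpBounds.
Context {R : realType}.
Implicit Types (x u N : R).

Lemma prod1D_le_expR_sum {I : eqType} (s : seq I) (P : pred I) (F : I -> R) :
  (forall i, i \in s -> P i -> 0 <= 1 + F i) ->
  \prod_(i <- s | P i) (1 + F i) <= expR (\sum_(i <- s | P i) F i).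
Proof.
move=> F1; rewrite expR_sum; apply: ler_prod_seq => i si Pi.
by rewrite F1 // expR_ge1Dx.
Qed.

Lemma expR_1subV_le u : 0 < u -> expR (1 - u^-1) <= u.
Proof.
move=> u0; rewrite -opprB expRN -[leRHS]invrK lef_pV2 ?posrE ?expR_gt0 ?invr_gt0 //.
by apply: le_trans (expR_ge1Dx _); rewrite subrKC.
Qed.

Lemma ln2_gt0 : 0 < ln 2 :> R.
Proof. by apply: ln_gt0; lra. Qed.

Lemma ln2_le_ln N : 2 <= N -> ln 2 <= ln N.
Proof. by move=> N2; rewrite ler_ln ?posrE //; lra. Qed.

Lemma ln_ge2_gt0 N : 2 <= N -> 0 < ln N.
Proof. by move=> N2; apply: lt_le_trans ln2_gt0 (ln2_le_ln N2). Qed.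

Lemma ln_le_expR x u : 0 < x -> x <= expR u -> ln x <= u.
Proof. by move=> x0 xu; rewrite -[leRHS]expRK ler_ln ?posrE ?expR_gt0. Qed.

Lemma powR_gt0E x u : 0 < x -> x `^ u = expR (u * ln x).
Proof. by move=> x0; rewrite /powR gt_eqF. Qed.

Lemma exists_pow2_gt x : exists n, x < 2 ^+ n.
Proof.
exists (Num.truncn x).+1; apply: lt_le_trans (truncnS_gt _) _.
by rewrite -natrX ler_nat ltnW // ltn_expl.
Qed.

Lemma sum_invX2_le2 J : \sum_(j < J) (2 ^+ j)^-1 <= 2 :> R.
Proof.
have -> : \sum_(j < J) (2 ^+ j)^-1 = 2 - 2 * (2 ^+ J)^-1 :> R.
  elim: J => [|J IH]; first by rewrite big_ord0 expr0 invr1; lra.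
  by rewrite big_ord_recr /= IH exprS invfM; lra.
by rewrite gerBl mulr_ge0 // invr_ge0 exprn_ge0.
Qed.

End ExpBounds.

Section Subseqs.
Context {T : Type}.
Implicit Types s : seq T.

Fixpoint subseqs s : seq (seq T) :=
  if s is x :: s' then subseqs s' ++ map (cons x) (subseqs s') else [:: [::]].

Lemma prod1D_subseqs {R : comPzRingType} s (w : T -> R) :
  \prod_(p <- s) (1 + w p) = \sum_(D <- subseqs s) \prod_(p <- D) w p.
Proof.
elim: s => [|p s IH]; first by rewrite big_nil big_seq1 big_nil.
rewrite big_cons IH /= big_cat big_map /= mulrDl mul1r; congr (_ + _).
by rewrite big_distrr /=; apply: eq_bigr => D _; rewrite big_cons.
Qed.

End Subseqs.

Section EqSubseqs.
Context {T : eqType}.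
Implicit Types a s D : seq T.

Lemma subseq_subseqs a s : subseq a s -> subseq (subseqs a) (subseqs s).
Proof.
elim: s a => [|y s IH] a; first by rewrite subseq0 => /eqP ->.
case: a => [_|x a] /=.
  by apply: subseq_trans (IH [::] (sub0seq _)) _; apply: prefix_subseq.
case: eqP => [->|_] sub.
  by apply: cat_subseq; [|apply: map_subseq]; apply: IH.
by apply: subseq_trans (IH _ sub) _; apply: prefix_subseq.
Qed.

Lemma mem_subseqs D s : D \in subseqs s -> subseq D s.
Proof.
elim: s D => [|y s IH] D; first by rewrite inE => /eqP ->.
rewrite mem_cat => /orP[/IH sub|/mapP[D' /IH sub ->]].
  by apply: subseq_trans sub (subseq_cons _ _).
by rewrite /= eqxx.
Qed.

Lemma prod_subseqs_ge0 {R : numDomainType} s D (w : T -> R) :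
  {in s, forall p, 0 <= w p} -> D \in subseqs s -> 0 <= \prod_(p <- D) w p.
Proof.
move=> w0 /mem_subseqs/mem_subseq sub.
by apply: prodr_ge0_seq => p /sub/w0.
Qed.

End EqSubseqs.

Section Modulus.
Context {R : realType}.
Implicit Types (s D : seq nat).

(* A squarefree modulus is represented by the list of its prime factors. *)
Definition modulus D : R := \prod_(p <- D) p%:R.

Lemma modulus_nil : modulus [::] = 1.
Proof. exact: big_nil. Qed.

Lemma modulus_cons p D : modulus (p :: D) = p%:R * modulus D.
Proof. exact: big_cons. Qed.

Lemma modulus_ge0 D : 0 <= modulus D.
Proof. exact: prodr_ge0. Qed.

Lemma modulus_ge1 D : all prime D -> 1 <= modulus D.
Proof.
move=> /allP primeD; apply: prodr_ge1_seq => p /primeD pp _.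
by rewrite ler1n prime_gt0.
Qed.

Lemma modulus_gt0 D : all prime D -> 0 < modulus D.
Proof. by move/modulus_ge1; apply: lt_le_trans. Qed.

Lemma modulus_subseq D s : all prime s -> subseq D s -> modulus D <= modulus s.
Proof.
move=> ps /perm_to_subseq[t perm_s]; rewrite /modulus (perm_big _ perm_s) big_cat.
rewrite ler_peMr ?modulus_ge0 // modulus_ge1 //.
by move: ps; rewrite (perm_all _ perm_s) all_cat => /andP[].
Qed.

Lemma ler_mem_modulus p s : all prime s -> p \in s -> p%:R <= modulus s.
Proof.
move=> ps sp; have := @modulus_subseq [:: p] s ps; rewrite sub1seq => /(_ sp).
by rewrite modulus_cons modulus_nil mulr1.
Qed.

Lemma modulus_powR D (k : R) : modulus D `^ k = \prod_(p <- D) p%:R `^ k.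
Proof.
elim: D => [|p D IH]; first by rewrite modulus_nil big_nil powR1.
by rewrite modulus_cons big_cons powRM ?IH // modulus_ge0.
Qed.

Lemma modulusX D k : modulus D ^+ k = \prod_(p <- D) p%:R ^+ k.
Proof. by rewrite prodrXl. Qed.

Lemma expR_size_le_modulus s (t : R) :
  all (fun p => expR t < p%:R) s -> expR ((size s)%:R * t) <= modulus s.
Proof.
move=> /allP tlts; rewrite -sum1_size natr_sum big_distrl /= expR_sum.
by apply: ler_prod_seq => p /tlts ltp _; rewrite mul1r expR_ge0 ltW.
Qed.

Lemma expn_size_le_powR (alpha t u : R) s : 1 <= alpha -> 0 < t ->
  all (fun p => expR t < p%:R) s -> modulus s <= expR u ->
  alpha ^+ size s <= alpha `^ (u / t).
Proof.
move=> alpha1 t0 tlts su; rewrite -powR_mulrn ?(le_trans ler01) //.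
rewrite ler_powR // ler_pdivlMr // -ler_expR.
exact: le_trans (expR_size_le_modulus tlts) su.
Qed.

End Modulus.

Arguments modulus {R} D.

Section TruncatedEulerProduct.
Context {R : realType}.
Implicit Types (s D : seq nat) (Q k : R) (w : nat -> R).

Definition trunc_euler_prod s Q w : R :=
  \sum_(D <- subseqs s | modulus D <= Q) \prod_(p <- D) w p.

Lemma trunc_euler_prod_ge0 s Q w : {in s, forall p, 0 <= w p} ->
  0 <= trunc_euler_prod s Q w.
Proof. by move=> w0; apply: sumr_ge0_seq => D sD _; apply: prod_subseqs_ge0 sD. Qed.

Lemma trunc_euler_prod_le s Q w : {in s, forall p, 0 <= w p} ->
  trunc_euler_prod s Q w <= \prod_(p <- s) (1 + w p).
Proof.
move=> w0; rewrite prod1D_subseqs; apply: ler_sum_seq_sub => // D sD _.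
exact: prod_subseqs_ge0 sD.
Qed.

Lemma trunc_euler_prod_ge a s Q w : {in s, forall p, 0 <= w p} -> all prime a ->
  subseq a s -> modulus a <= Q -> \prod_(p <- a) (1 + w p) <= trunc_euler_prod s Q w.
Proof.
move=> w0 ap sub aQ; rewrite prod1D_subseqs.
apply: le_trans (_ : _ <= trunc_euler_prod a Q w) _.
  apply: ler_sum_seq_sub => D sD _.
    by apply: le_trans aQ; apply: modulus_subseq ap (mem_subseqs sD).
  by apply: prod_subseqs_ge0 sD => p /(mem_subseq sub)/w0.
apply: ler_sum_subseq; first exact: subseq_subseqs.
by move=> D sD _; apply: prod_subseqs_ge0 sD.
Qed.

Lemma rankin_tail s Q w k : {in s, forall p, 0 <= w p} -> 0 <= k -> 0 < Q ->
  \prod_(p <- s) (1 + w p) - trunc_euler_prod s Q w <=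
  Q `^ (- k) * \prod_(p <- s) (1 + w p * p%:R `^ k).
Proof.
move=> w0 k0 Q0; rewrite !prod1D_subseqs (bigID (fun D => modulus D <= Q)) /=.
rewrite addrAC subrr add0r big_distrr /=.
apply: le_trans (ler_sum_seq (_ : forall D, D \in subseqs s -> ~~ (modulus D <= Q) ->
  _ <= Q `^ (- k) * \prod_(p <- D) (w p * p%:R `^ k))) _.
  move=> D sD; rewrite -ltNge => QD.
  rewrite big_split /= -modulus_powR mulrCA ler_peMr ?(prod_subseqs_ge0 w0 sD) //.
  rewrite powRN mulrC ler_pdivlMr ?powR_gt0 // mul1r.
  by rewrite ge0_ler_powR ?nnegrE ?modulus_ge0 // ltW.
apply: ler_sum_seq_sub => // D sD _; rewrite mulr_ge0 ?powR_ge0 //.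
by apply: prod_subseqs_ge0 sD => p /w0 wp; rewrite mulr_ge0 ?powR_ge0.
Qed.

Lemma trunc_euler_prod_leX s Q w n : 0 <= Q ->
  {in s, forall p, 0 <= w p} -> all prime s ->
  trunc_euler_prod s Q w <= Q ^+ n * \prod_(p <- s) (1 + w p / p%:R ^+ n).
Proof.
move=> Q0 w0 /allP sp; rewrite prod1D_subseqs big_distrr /=.
apply: le_trans (ler_sum_seq (_ : forall D, D \in subseqs s -> modulus D <= Q ->
  _ <= Q ^+ n * \prod_(p <- D) (w p / p%:R ^+ n))) _.
  move=> D sD DQ; have D0 : 0 < modulus D :> R.
    by apply: modulus_gt0; apply/allP => p /(mem_subseq (mem_subseqs sD))/sp.
  rewrite big_split /= mulrCA ler_peMr ?(prod_subseqs_ge0 w0 sD) //.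
  rewrite prodfV -modulusX ler_pdivlMr ?exprn_gt0 // mul1r.
  by rewrite lerXn2r ?nnegrE ?(ltW D0).
apply: ler_sum_seq_sub => // D sD _; rewrite mulr_ge0 ?exprn_ge0 //.
by apply: prod_subseqs_ge0 sD => p /w0 wp; rewrite divr_ge0 ?exprn_ge0.
Qed.

End TruncatedEulerProduct.

Section PrimesUpto.
Context {R : realType}.
Implicit Types (y z : R).

Definition primes_upto z : seq nat :=
  [seq p <- iota 0 (Num.truncn z).+1 | prime p].

Definition primes_between y z : seq nat := [seq p <- primes_upto z | y < p%:R].

Lemma mem_primes_upto z p : (p \in primes_upto z) = prime p && (p%:R <= z).
Proof.
rewrite mem_filter mem_iota add0n ltnS /=; case: (boolP (prime p)) => //.
by case: p => // p _; rewrite truncn_gt_nat.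
Qed.

Lemma mem_primes_between y z p :
  (p \in primes_between y z) = [&& y < p%:R, prime p & p%:R <= z].
Proof. by rewrite mem_filter mem_primes_upto. Qed.

Lemma all_prime_primes_upto z : all prime (primes_upto z).
Proof. exact: filter_all. Qed.

Lemma all_prime_filter_primes_upto (P : pred nat) z :
  all prime [seq p <- primes_upto z | P p].
Proof. by apply/allP => p; rewrite mem_filter mem_primes_upto => /and3P[]. Qed.

Lemma all_prime_primes_between y z : all prime (primes_between y z).
Proof. exact: all_prime_filter_primes_upto. Qed.

Lemma primes_upto_uniq z : uniq (primes_upto z).
Proof. by rewrite filter_uniq // iota_uniq. Qed.

Lemma primes_between_uniq y z : uniq (primes_between y z).
Proof. exact: filter_uniq (primes_upto_uniq z). Qed.

Lemma primes_upto_sorted z : sorted ltn (primes_upto z).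
Proof. by rewrite sorted_filter ?iota_ltn_sorted //; apply: ltn_trans. Qed.

Lemma subseq_primes_upto s z : sorted ltn s -> all prime s ->
  all (fun p => p%:R <= z) s -> subseq s (primes_upto z).
Proof.
move=> sorted_s /allP ps /allP sz.
suff -> : s = [seq p <- primes_upto z | p \in s] by apply: filter_subseq.
apply: (irr_sorted_eq ltn_trans ltnn) => //.
  by apply: sorted_filter; [exact: ltn_trans|exact: primes_upto_sorted].
move=> p; rewrite mem_filter mem_primes_upto.
by case sp: (p \in s) => //=; rewrite ps // sz.
Qed.

Lemma size_primes_upto z : (size (primes_upto z) <= Num.truncn z)%N.
Proof. by rewrite size_filter /= add0n (leq_trans (count_size _ _)) // size_iota. Qed.

Lemma primes_upto_lt2 z : z < 2 -> primes_upto z = [::].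
Proof.
move=> z2; apply/eqP; rewrite -size_eq0 -leqn0 leqNgt -has_predT; apply/hasPn => p.
rewrite mem_primes_upto => /andP[/prime_gt1 p1 pz].
by move: (le_lt_trans pz z2); rewrite ltr_nat ltnNge p1.
Qed.

Lemma primes_upto_cat y z : y <= z ->
  primes_upto z = primes_upto y ++ primes_between y z.
Proof.
move=> yz; apply: (irr_sorted_eq ltn_trans ltnn); first exact: primes_upto_sorted.
  rewrite sorted_pairwise ?pairwise_cat; last exact: ltn_trans.
  rewrite -!(sorted_pairwise ltn_trans) primes_upto_sorted.
  rewrite (sorted_filter ltn_trans) ?primes_upto_sorted // !andbT.
  apply/allrelP => p q; rewrite mem_primes_upto mem_primes_between.
  by move=> /andP[_ py] /and3P[yq _ _]; rewrite -(ltr_nat R) (le_lt_trans py).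
move=> p; rewrite mem_cat mem_primes_between !mem_primes_upto.
case: (prime p) => //=; rewrite ?andbF //.
by case: leP => //= py; rewrite (le_trans py yz).
Qed.

Lemma sum_primes_leE z (g : nat -> R) :
  sum_primes_le z g = \sum_(p <- primes_upto z) g p.
Proof. by rewrite big_filter /sum_primes_le -(big_mkord prime) /index_iota subn0. Qed.

Lemma sum_inv_sqr_le n : \sum_(1 <= m < n.+2) (m%:R ^+ 2)^-1 <= 2 - n.+1%:R^-1 :> R.
Proof.
elim: n => [|n IH]; first by rewrite big_nat1 expr1n invr1; lra.
rewrite big_nat_recr //=; apply: le_trans (lerD IH (lexx _)) _.
have n0 : 0 < n.+1%:R :> R by rewrite ltr0n.
rewrite -[n.+2%:R]natr1; move: n.+1%:R n0 => x x0.
suff : ((x + 1) ^+ 2)^-1 <= x^-1 - (x + 1)^-1 by lra.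
have -> : x^-1 - (x + 1)^-1 = (x * (x + 1))^-1 by field; apply/andP; split; lra.
by rewrite lef_pV2 ?posrE ?mulr_gt0 ?exprn_gt0 //; nra.
Qed.

Lemma sum_primes_inv_sqr_le2 z : \sum_(p <- primes_upto z) (p%:R ^+ 2)^-1 <= 2 :> R.
Proof.
rewrite big_filter; apply: le_trans (_ : _ <= 2 - (Num.truncn z).+1%:R^-1) _; last first.
  by rewrite gerBl invr_ge0.
apply: le_trans (sum_inv_sqr_le _).
apply: le_trans (_ : _ <= \sum_(1 <= m < (Num.truncn z).+1) (m%:R ^+ 2)^-1) _.
  rewrite /= big_cons /index_iota subn1.
  by apply: ler_sum_seq_sub => // p _ _; rewrite invr_ge0 exprn_ge0.
by rewrite [leRHS]big_nat_recr //= lerDl invr_ge0 exprn_ge0.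
Qed.

Lemma prod_primes_inv_sqr_le z (A : R) : 0 <= A ->
  \prod_(p <- primes_upto z) (1 + A / p%:R ^+ 2) <= expR (2 * A).
Proof.
move=> A0; apply: le_trans (prod1D_le_expR_sum _) _.
  by move=> p _ _; rewrite addr_ge0 // divr_ge0 // exprn_ge0.
by rewrite ler_expR -big_distrr /= mulrC ler_wpM2r // sum_primes_inv_sqr_le2.
Qed.

End PrimesUpto.

Section PrimePowers.
Context {R : realType}.
Implicit Types (k t K : R) (p : nat).

Lemma powR_prime_ge1 p k : prime p -> 0 <= k -> 1 <= p%:R `^ k.
Proof.
by move=> pp k0; rewrite -[leLHS](powRr0 p%:R) ler_powR // ler1n prime_gt0.
Qed.

Lemma powR_prime_le_expR p k t K : prime p -> 0 <= k -> k * t <= K ->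
  p%:R <= expR t -> p%:R `^ k <= expR K.
Proof.
move=> pp k0 ktK pt; have p0 : 0 < p%:R :> R by rewrite ltr0n prime_gt0.
rewrite powR_gt0E // ler_expR; apply: le_trans ktK.
by rewrite ler_wpM2l // ln_le_expR.
Qed.

Lemma powR_prime_sub1_le p k t K : prime p -> 0 <= k -> k * t <= K ->
  p%:R <= expR t -> p%:R `^ k - 1 <= k * ln p%:R * expR K.
Proof.
move=> pp k0 ktK pt; apply: le_trans (_ : _ <= k * ln p%:R * p%:R `^ k) _.
  have p0 : 0 < p%:R :> R by rewrite ltr0n prime_gt0.
  rewrite powR_gt0E // lerBlDr addrC -lerBlDr -[X in X - _]mul1r -mulrBl.
  rewrite -ler_pdivlMr ?expR_gt0 // div1r -expRN; exact: expR_ge1Dx.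
apply: ler_wpM2l (powR_prime_le_expR pp k0 ktK pt).
by rewrite mulr_ge0 // ln_ge0 // ler1n prime_gt0.
Qed.

End PrimePowers.

Definition prob_on_primes {R : realType} (eta : nat -> R) : Prop :=
  forall p, prime p -> 0 <= eta p <= 1.

Definition mertens {R : realType} (c M E : R) (eta : nat -> R) : Prop :=
  forall N, 2 <= N ->
    `| \sum_(p <- primes_upto N) eta p - (c * ln (ln N) + M) | <= E / ln N.

Definition dyadic_mass_le {R : realType} (L : R) (eta : nat -> R) : Prop :=
  forall l : R, 0 <= l ->
    \sum_(p <- primes_between (expR (l / 2)) (expR l)) eta p <= L.

(* The term [4] covers the scales [expR l < 4], whose lower half is out of Mertens' range. *)
Definition dyadic_bound {R : realType} (c E : R) : R :=
  c * ln 2 + 2 * (`|E| / ln 2) + 4.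

Lemma dyadic_bound_ge0 {R : realType} (c E : R) : 0 <= c -> 0 <= dyadic_bound c E.
Proof. by move=> c0; rewrite !addr_ge0 ?mulr_ge0 ?invr_ge0 // ltW // ln2_gt0. Qed.

Section Mertens.
Context {R : realType} (c M E : R) (eta : nat -> R).
Hypotheses (c_ge0 : 0 <= c) (eta_prob : prob_on_primes eta).
Hypothesis eta_mertens : mertens c M E eta.
Implicit Types (l k K z N : R).

Lemma prob_primes_upto_ge0 z p : p \in primes_upto z -> 0 <= eta p.
Proof. by rewrite mem_primes_upto => /andP[/eta_prob/andP[]]. Qed.

Lemma prob_sum_ge0 z : 0 <= \sum_(p <- primes_upto z) eta p.
Proof. by apply: sumr_ge0_seq => p pz _; apply: prob_primes_upto_ge0 pz. Qed.

Lemma prob_sum_le z : 0 <= z -> \sum_(p <- primes_upto z) eta p <= z.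
Proof.
move=> z0; apply: le_trans (_ : _ <= \sum_(p <- primes_upto z) 1) _.
  by apply: ler_sum_seq => p; rewrite mem_primes_upto => /andP[/eta_prob/andP[]].
rewrite sumr_const_seq count_predT.
apply: le_trans (_ : (Num.truncn z)%:R <= z); last by rewrite truncn_le.
by rewrite ler_nat size_primes_upto.
Qed.

Lemma mertens_error_le N : 2 <= N -> E / ln N <= `|E| / ln 2.
Proof.
move=> N2; apply: le_trans (_ : `|E| / ln N <= _).
  by rewrite ler_wpM2r ?ler_norm // invr_ge0 ltW // ln_ge2_gt0.
by rewrite ler_wpM2l // lef_pV2 ?posrE ?ln2_gt0 ?ln_ge2_gt0 // ln2_le_ln.
Qed.

Lemma mertens_sum_le N z : 2 <= N -> z <= N ->
  \sum_(p <- primes_upto z) eta p <= c * ln (ln N) + M + `|E| / ln 2.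
Proof.
move=> N2 zN; apply: le_trans (_ : _ <= \sum_(p <- primes_upto N) eta p) _.
  rewrite (primes_upto_cat zN) big_cat lerDl.
  by apply: sumr_ge0_seq => p; rewrite mem_primes_between => /and3P[_ /eta_prob/andP[]].
rewrite -lerBlDl; apply: le_trans (mertens_error_le N2).
exact: le_trans (ler_norm _) (eta_mertens N2).
Qed.

Lemma mertens_sum_ge N : 2 <= N ->
  c * ln (ln N) + M - `|E| / ln 2 <= \sum_(p <- primes_upto N) eta p.
Proof.
move=> N2; rewrite lerBlDr -lerBlDl; apply: le_trans (mertens_error_le N2).
by apply: le_trans (eta_mertens N2); rewrite distrC ler_norm.
Qed.

Lemma mertens_dyadic_mass : dyadic_mass_le (dyadic_bound c E) eta.
Proof.
move=> l l0; have half_le : expR (l / 2) <= expR l by rewrite ler_expR; lra.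
have cln2_ge0 : 0 <= c * ln 2 by rewrite mulr_ge0 // ltW // ln2_gt0.
have err_ge0 : 0 <= `|E| / ln 2 by rewrite divr_ge0 // ltW // ln2_gt0.
have [half_ge2|half_lt2] := leP 2 (expR (l / 2)); last first.
  have : expR l <= 4.
    by rewrite [l]splitr expRD; have := expR_gt0 (l / 2); nra.
  have := prob_sum_le (expR_ge0 l); have := prob_sum_ge0 (expR (l / 2)).
  by rewrite (primes_upto_cat half_le) big_cat /= /dyadic_bound; lra.
have l_gt0 : 0 < l.
  by have := ln_ge2_gt0 half_ge2; rewrite expRK; lra.
have := mertens_sum_ge half_ge2.
have := mertens_sum_le (le_trans half_ge2 half_le) (lexx _).
rewrite (primes_upto_cat half_le) big_cat /= !expRK ln_div ?posrE // /dyadic_bound.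
lra.
Qed.

Lemma mertens_sum_ln_le l : 0 <= l ->
  \sum_(p <- primes_upto (expR l)) eta p * ln p%:R <= 2 * dyadic_bound c E * l.
Proof.
have bound_ge0 := dyadic_bound_ge0 E c_ge0.
suff bound_below n m : 0 <= m -> m < ln 2 * 2 ^+ n ->
    \sum_(p <- primes_upto (expR m)) eta p * ln p%:R <= 2 * dyadic_bound c E * m.
  move=> l0; have [n lt_n] := exists_pow2_gt (l / ln 2).
  by apply: (bound_below n) => //; rewrite mulrC -ltr_pdivrMr // ln2_gt0.
elim: n m => [|n IH] m m0 mn.
  rewrite primes_upto_lt2 ?big_nil ?mulr_ge0 //.
  by rewrite -[ltRHS]lnK ?posrE ?ltr_expR //; lra.
rewrite exprS in mn; have {}IH := IH (m / 2) ltac:(lra) ltac:(lra).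
have half_le : expR (m / 2) <= expR m by rewrite ler_expR; lra.
have upper_half : \sum_(p <- primes_between (expR (m / 2)) (expR m)) eta p * ln p%:R
    <= m * \sum_(p <- primes_between (expR (m / 2)) (expR m)) eta p.
  rewrite big_distrr /=; apply: ler_sum_seq => p.
  rewrite mem_primes_between => /and3P[_ pp pm] _; rewrite mulrC.
  have /andP[eta0 _] := eta_prob pp; apply: ler_wpM2r => //.
  by apply: ln_le_expR => //; rewrite ltr0n prime_gt0.
rewrite (primes_upto_cat half_le) big_cat /=.
have := ler_wpM2l m0 (mertens_dyadic_mass m0); lra.
Qed.

(* Rankin's trick costs only a constant factor as long as [p^k] stays bounded. *)
Lemma mertens_sum_powR_sub1_le l k K : 0 <= l -> 0 <= k -> k * l <= K ->
  \sum_(p <- primes_upto (expR l)) eta p * (p%:R `^ k - 1)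
    <= 2 * dyadic_bound c E * K * expR K.
Proof.
move=> l0 k0 klK.
apply: le_trans (_ : _ <= k * expR K *
    \sum_(p <- primes_upto (expR l)) eta p * ln p%:R) _.
  rewrite big_distrr /=; apply: ler_sum_seq => p pl _.
  have eta0 := prob_primes_upto_ge0 pl; move: pl; rewrite mem_primes_upto => /andP[pp pl].
  rewrite mulrCA ler_wpM2l // mulrAC; exact: powR_prime_sub1_le klK pl.
apply: le_trans (ler_wpM2l _ (mertens_sum_ln_le l0)) _; first by rewrite mulr_ge0 ?expR_ge0.
have -> : k * expR K * (2 * dyadic_bound c E * l) =
  2 * dyadic_bound c E * (k * l) * expR K by ring.
by rewrite ler_wpM2r ?expR_ge0 // ler_wpM2l // mulr_ge0 // dyadic_bound_ge0.
Qed.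

End Mertens.

Lemma exprD_ge_head2 {R : realDomainType} (x y : R) n : 0 <= x -> 0 <= y ->
  x ^+ n.+1 + n.+1%:R * y * x ^+ n <= (y + x) ^+ n.+1.
Proof.
move=> x0 y0; elim: n => [|n IH]; first by rewrite !expr1 expr0; lra.
rewrite [leRHS]exprS; apply: le_trans (ler_wpM2l (addr_ge0 y0 x0) IH).
have -> : (y + x) * (x ^+ n.+1 + n.+1%:R * y * x ^+ n) =
    x ^+ n.+2 + n.+2%:R * y * x ^+ n.+1 + n.+1%:R * y ^+ 2 * x ^+ n.
  by rewrite -[n.+2%:R]natr1 !exprS; ring.
by rewrite lerDl !mulr_ge0 ?exprn_ge0.
Qed.

Section ElementarySymmetric.
Context {T : eqType} {R : realFieldType}.
Implicit Types (s : seq T) (y : T -> R) (k : nat).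

Fixpoint elem_sym y k s : R :=
  match s, k with
  | _, 0 => 1
  | [::], _.+1 => 0
  | p :: s', k'.+1 => elem_sym y k s' + y p * elem_sym y k' s'
  end.

Lemma elem_sym0 y s : elem_sym y 0 s = 1.
Proof. by case: s. Qed.

Lemma elem_sym_ge0 y k s : {in s, forall p, 0 <= y p} -> 0 <= elem_sym y k s.
Proof.
elim: s k => [|p s IH] [|k] //= y0; have /forall_cons[yp0 ys0] := y0.
by rewrite addr_ge0 ?mulr_ge0 ?IH.
Qed.

Lemma elem_sym_le_expn y k s : {in s, forall p, 0 <= y p} ->
  elem_sym y k s <= (\sum_(p <- s) y p) ^+ k / k`!%:R.
Proof.
elim: s k => [|p s IH] [|k] y0; rewrite ?elem_sym0 ?fact0 ?expr0 ?divr1 //=.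
  by rewrite big_nil expr0n mul0r.
have /forall_cons[yp0 ys0] := y0.
apply: le_trans (lerD (IH k.+1 ys0) (ler_wpM2l yp0 (IH k ys0))) _.
have sum0 : 0 <= \sum_(q <- s) y q by apply: sumr_ge0_seq => q /ys0.
have kfact_gt0 : 0 < k`!%:R :> R by rewrite ltr0n fact_gt0.
rewrite big_cons factS natrM ler_pdivlMr ?mulr_gt0 //.
have := exprD_ge_head2 k sum0 yp0; congr (_ <= _).
by field; rewrite gt_eqF //= pnatr_eq0.
Qed.

Lemma sum_elem_sym_le y k s : {in s, forall p, 0 <= y p} ->
  \sum_(i < k.+1) elem_sym y i s <= \prod_(p <- s) (1 + y p).
Proof.
elim: s k => [|p s IH] k y0.
  by rewrite big_nil big_ord_recl big1 /= ?addr0.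
have /forall_cons[yp0 ys0] := y0.
rewrite big_cons mulrDl mul1r; case: k => [|k].
  rewrite big_ord_recl big_ord0 elem_sym0 addr0.
  have prod_ge1 : 1 <= \prod_(q <- s) (1 + y q).
    by apply: prodr_ge1_seq => q /ys0 yq0 _; rewrite lerDl.
  have prod_ge0 := le_trans ler01 prod_ge1.
  by apply: le_trans prod_ge1 _; rewrite lerDl mulr_ge0.
have -> : \sum_(i < k.+2) elem_sym y i (p :: s) =
    \sum_(i < k.+2) elem_sym y i s + y p * \sum_(i < k.+1) elem_sym y i s.
  rewrite big_ord_recl [X in _ = X + _]big_ord_recl !elem_sym0 -addrA.
  by congr (_ + _); rewrite big_distrr -big_split.
by rewrite lerD ?ler_wpM2l ?IH.
Qed.

(* The inclusion-exclusion expansion of [\prod_(p <- s) (1 - y p)], cut at degree [k]. *)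
Definition bonferroni y k s : R := \sum_(i < k.+1) (-1) ^+ i * elem_sym y i s.

Lemma bonferroni0 y s : bonferroni y 0 s = 1.
Proof. by rewrite /bonferroni big_ord_recl big_ord0 elem_sym0 mulr1 addr0. Qed.

Lemma bonferroniS y k s :
  bonferroni y k.+1 s = bonferroni y k s + (-1) ^+ k.+1 * elem_sym y k.+1 s.
Proof. exact: big_ord_recr. Qed.

Lemma bonferroni_cons y k p s :
  bonferroni y k.+1 (p :: s) = bonferroni y k.+1 s - y p * bonferroni y k s.
Proof.
rewrite /bonferroni big_ord_recl [X in _ = X - _]big_ord_recl !elem_sym0 -addrA.
congr (_ + _); rewrite big_distrr /= -sumrB; apply: eq_bigr => i _ /=.
by rewrite /bump /= add1n exprS; ring.
Qed.

Lemma bonferroni_sign y k s : {in s, forall p, 0 <= y p <= 1} ->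
  0 <= (-1) ^+ k * (bonferroni y k s - \prod_(p <- s) (1 - y p)).
Proof.
elim: s k => [|p s IH] k y01.
  rewrite /bonferroni big_nil big_ord_recl big1 /=.
    by rewrite expr0 mul1r addr0 subrr mulr0.
  by move=> i _; rewrite mulr0.
have /forall_cons[/andP[yp0 yp1] ys01] := y01.
case: k => [|k].
  rewrite bonferroni0 expr0 mul1r subr_ge0; apply: prodr_le1_seq => q /y01.
  by move=> /andP[yq0 yq1] _; rewrite subr_ge0 yq1 gerBl.
have := addr_ge0 (IH k.+1 ys01) (mulr_ge0 yp0 (IH k ys01)).
rewrite big_cons bonferroni_cons exprS; congr (0 <= _); ring.
Qed.

Lemma bonferroni_even_ge y k s : ~~ odd k -> {in s, forall p, 0 <= y p <= 1} ->
  \prod_(p <- s) (1 - y p) <= bonferroni y k s.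
Proof.
move=> even_k /(bonferroni_sign k).
by rewrite -signr_odd (negbTE even_k) expr0 mul1r subr_ge0.
Qed.

Lemma bonferroni_even_le y k s : ~~ odd k -> {in s, forall p, 0 <= y p <= 1} ->
  bonferroni y k s - elem_sym y k.+1 s <= \prod_(p <- s) (1 - y p).
Proof.
move=> even_k /(bonferroni_sign k.+1).
by rewrite bonferroniS -signr_odd /= (negbTE even_k) expr1 !mulN1r oppr_ge0 subr_le0.
Qed.

End ElementarySymmetric.

Section BonferroniRemainder.
Context {T : eqType} {R : realType}.
Implicit Types (s : seq T) (y : T -> R) (k : nat).

(* Since [(4 L) ^ k.+1 / k.+1! <= expR (4 L)], the first omitted term gains [4 ^ k.+1]. *)
Lemma elem_sym_le_bonferroni y k s (L B : R) : ~~ odd k ->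
  {in s, forall p, 0 <= y p <= 1} -> \sum_(p <- s) y p <= L ->
  expR (- B) <= \prod_(p <- s) (1 - y p) -> expR (4 * L + B) <= 2 ^+ k ->
  elem_sym y k.+1 s <= (2 ^+ k)^-1 * bonferroni y k s.
Proof.
move=> even_k y01 sumL prodB k_large.
have y0 : {in s, forall p, 0 <= y p} by move=> p /y01/andP[].
have sum0 : 0 <= \sum_(p <- s) y p by apply: sumr_ge0_seq => p /y0.
have L0 := le_trans sum0 sumL.
have pow_gt0 : 0 < 2 ^+ k :> R by rewrite exprn_gt0.
have exp_term : L ^+ k.+1 / k.+1`!%:R <= expR (4 * L) / 4 ^+ k.+1.
  have := expR_ge1Dxn k (mulr_ge0 (ler0n R 4) L0).
  rewrite exprMn -mulrA => /(le_trans _) le_exp.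
  by rewrite ler_pdivlMr ?exprn_gt0 // mulrC; apply: le_exp; rewrite lerDr.
have pow4 : 2 ^+ k * 2 ^+ k <= 4 ^+ k.+1 :> R.
  have -> : 4 = 2 * 2 :> R by rewrite -natrM.
  rewrite -exprMn ler_weXn2l //; lra.
apply: le_trans (ler_wpM2l _ (le_trans prodB (bonferroni_even_ge even_k y01))); last first.
  by rewrite invr_ge0 ltW.
apply: le_trans (elem_sym_le_expn k.+1 y0) _.
apply: le_trans (_ : _ <= L ^+ k.+1 / k.+1`!%:R) _.
  by rewrite ler_wpM2r ?invr_ge0 // lerXn2r ?nnegrE.
apply: le_trans exp_term _; rewrite ler_pdivrMr ?exprn_gt0 //.
have -> : expR (4 * L) = expR (4 * L + B) * expR (- B) by rewrite -expRD addrK.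
rewrite mulrAC ler_wpM2r ?expR_ge0 //; apply: le_trans k_large _.
by rewrite -ler_pdivrMl ?invr_gt0 // invrK.
Qed.

End BonferroniRemainder.

Section Hooley.
Context {T : eqType} {R : realFieldType}.
Implicit Types (s : seq T) (k : nat) (ls : seq (seq T * nat)) (y : T -> R).

Definition layers_support ls : seq T := flatten (unzip1 ls).

Fixpoint hooley_up y ls : R :=
  if ls is (s, k) :: ls' then hooley_up y ls' * bonferroni y k s else 1.

(* If [P, P'] are products with upper approximations [b, U] and lower ones [b - e, L],
   then [P' * P >= P' * (b - e) >= L * b - U * e]. *)
Fixpoint hooley_lo y ls : R :=
  if ls is (s, k) :: ls'
  then hooley_lo y ls' * bonferroni y k s - hooley_up y ls' * elem_sym y k.+1 s else 1.

Definition hooley_prod y ls : R := \prod_(p <- layers_support ls) (1 - y p).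

Lemma hooley_prod_cons y s k ls :
  hooley_prod y ((s, k) :: ls) = \prod_(p <- s) (1 - y p) * hooley_prod y ls.
Proof. by rewrite /hooley_prod big_cat. Qed.

Lemma layers_support_cons {s k ls} {P : T -> Prop} :
  {in layers_support ((s, k) :: ls), forall p, P p} ->
  {in s, forall p, P p} /\ {in layers_support ls, forall p, P p}.
Proof. by move=> inP; split=> p ps; apply: inP; rewrite mem_cat ps ?orbT. Qed.

Lemma prod_1sub_ge0 y s : {in s, forall p, 0 <= y p <= 1} -> 0 <= \prod_(p <- s) (1 - y p).
Proof. by move=> y01; apply: prodr_ge0_seq => p /y01/andP[_ yp1] _; rewrite subr_ge0. Qed.

Lemma hooley_up_ge y ls : all (fun sk => ~~ odd sk.2) ls ->
  {in layers_support ls, forall p, 0 <= y p <= 1} -> hooley_prod y ls <= hooley_up y ls.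
Proof.
elim: ls => [_ _|[s k] ls IH /= /andP[even_k even_ls] y01].
  by rewrite /hooley_prod big_nil.
have [ys01 yls01] := layers_support_cons y01.
by rewrite hooley_prod_cons mulrC ler_pM ?prod_1sub_ge0 ?IH ?bonferroni_even_ge.
Qed.

Lemma hooley_lo_le y ls : all (fun sk => ~~ odd sk.2) ls ->
  {in layers_support ls, forall p, 0 <= y p <= 1} -> hooley_lo y ls <= hooley_prod y ls.
Proof.
elim: ls => [_ _|[s k] ls IH /= /andP[even_k even_ls] y01].
  by rewrite /hooley_prod big_nil.
have [ys01 yls01] := layers_support_cons y01.
have prod0 : 0 <= hooley_prod y ls by apply: prod_1sub_ge0.
have elem0 : 0 <= elem_sym y k.+1 s by apply: elem_sym_ge0 => p /ys01/andP[].
have bonf0 := le_trans (prod_1sub_ge0 ys01) (bonferroni_even_ge even_k ys01).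
rewrite hooley_prod_cons [leRHS]mulrC.
apply: le_trans (ler_wpM2l prod0 (bonferroni_even_le even_k ys01)).
by rewrite mulrBr lerB ?ler_wpM2r ?IH ?hooley_up_ge.
Qed.

Lemma hooley_lo_ge y (r : seq T * nat -> R) ls : all (fun sk => ~~ odd sk.2) ls ->
  {in layers_support ls, forall p, 0 <= y p <= 1} ->
  {in ls, forall sk, elem_sym y sk.2.+1 sk.1 <= r sk * bonferroni y sk.2 sk.1} ->
  (1 - \sum_(sk <- ls) r sk) * hooley_up y ls <= hooley_lo y ls.
Proof.
elim: ls => [_ _ _|[s k] ls IH /= /andP[even_k even_ls] y01 /forall_cons[/= rem_s rem_ls]].
  by rewrite big_nil subr0 mulr1.
have [ys01 yls01] := layers_support_cons y01.
have up0 := le_trans (prod_1sub_ge0 yls01) (hooley_up_ge even_ls yls01).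
have bonf0 := le_trans (prod_1sub_ge0 ys01) (bonferroni_even_ge even_k ys01).
have := lerB (ler_wpM2r bonf0 (IH even_ls yls01 rem_ls)) (ler_wpM2l up0 rem_s).
by rewrite big_cons; congr (_ <= _); ring.
Qed.

End Hooley.

Section Equidistribution.
Context {R : realType} {A : Type}.
Variables (X : seq A) (g : A -> R) (ind : nat -> A -> R) (eta : nat -> R).
Variables (M E Y : R).
Implicit Types (B D s : seq nat) (F : A -> R) (v w Q z : R) (k : nat).

Definition equidistributed B : Prop := forall D,
  uniq D -> all prime D -> {in D, forall p, p \notin B} -> modulus D <= Y ->
  `| \sum_(x <- X) g x * \prod_(p <- D) ind p x - M * \prod_(p <- D) eta p | <= E.

(* [F] is a polynomial in the indicators [ind p], [p \in B], whose monomials have moduli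
   at most [Q]; [v] is its value at [ind p := eta p], and [w] that of its absolute value at
   [ind p := 1 / p ^ 2].  The factor [(Y / modulus D) ^ 2] makes [w] multiplicative. *)
Definition sieve_approx B F v w Q : Prop := forall D,
  uniq D -> all prime D -> {in D, forall p, p \notin B} -> modulus D * Q <= Y ->
  `| \sum_(x <- X) g x * F x * \prod_(p <- D) ind p x
     - M * (v * \prod_(p <- D) eta p) | <= E * w * (Y / modulus D) ^+ 2.

Lemma eq_sieve_approx B F F' v v' w w' Q : F =1 F' -> v = v' -> w = w' ->
  sieve_approx B F v w Q -> sieve_approx B F' v' w' Q.
Proof.
move=> eqF <- <- approxF D uD pD DB DQ.
rewrite [X in `|X - _|](eq_bigr (fun x => g x * F x * \prod_(p <- D) ind p x)).
  exact: approxF.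
by move=> x _; rewrite eqF.
Qed.

Lemma sieve_approx_total B F v w Q : sieve_approx B F v w Q -> Q <= Y ->
  `| \sum_(x <- X) g x * F x - M * v | <= E * w * Y ^+ 2.
Proof.
move=> approxF QY; have := approxF [::]; rewrite big_nil modulus_nil mul1r mulr1 divr1.
rewrite (eq_bigr (fun x => g x * F x)); last by move=> x _; rewrite big_nil mulr1.
by apply.
Qed.

Lemma sieve_approx0 B Q : sieve_approx B (fun=> 0) 0 0 Q.
Proof.
move=> D uD pD DB DQ; rewrite big1 => [|x _]; last by rewrite mulr0 mul0r.
by rewrite mul0r !mulr0 mul0r subrr normr0.
Qed.

Lemma sieve_approxD B F1 F2 v1 v2 w1 w2 Q :
  sieve_approx B F1 v1 w1 Q -> sieve_approx B F2 v2 w2 Q ->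
  sieve_approx B (fun x => F1 x + F2 x) (v1 + v2) (w1 + w2) Q.
Proof.
move=> approx1 approx2 D uD pD DB DQ; rewrite mulrDr [leRHS]mulrDl.
have := le_trans (ler_normD _ _) (lerD (approx1 D uD pD DB DQ) (approx2 D uD pD DB DQ)).
congr (`| _ | <= _); rewrite addrACA -big_split /= mulrDl mulrDr opprD; congr (_ + _).
by apply: eq_bigr => x _; rewrite mulrDr mulrDl.
Qed.

Lemma sieve_approxZ (c : R) B F v w Q : sieve_approx B F v w Q ->
  sieve_approx B (fun x => c * F x) (c * v) (`|c| * w) Q.
Proof.
move=> approxF D uD pD DB DQ.
rewrite [X in `|X - _|](_ : _ =
    c * \sum_(x <- X) g x * F x * \prod_(p <- D) ind p x); last first.
  by rewrite big_distrr; apply: eq_bigr => x _ /=; ring.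
rewrite -mulrA [M * _]mulrCA -mulrBr normrM [E * _]mulrCA -[leRHS]mulrA.
by rewrite ler_wpM2l // approxF.
Qed.

Lemma sieve_approxM_ind p B F v w Q : prime p -> p \notin B -> sieve_approx B F v w Q ->
  sieve_approx (p :: B) (fun x => F x * ind p x) (v * eta p) (w / p%:R ^+ 2) (Q * p%:R).
Proof.
move=> pp pB approxF D uD pD DpB DQ.
have p_gt0 : 0 < p%:R :> R by rewrite ltr0n prime_gt0.
have D_gt0 : 0 < modulus D :> R by apply: modulus_gt0.
have pND : p \notin D by apply/negP => /DpB; rewrite mem_head.
have DB : {in p :: D, forall q, q \notin B}.
  by apply/forall_cons; split=> // q /DpB; rewrite inE negb_or => /andP[].
have DpQ : modulus (p :: D) * Q <= Y by rewrite modulus_cons -mulrA mulrC -mulrA.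
have := approxF (p :: D); rewrite /= pND pp => /(_ uD pD DB DpQ); rewrite modulus_cons.
rewrite [in X in X -> _](eq_bigr (fun x => g x * (F x * ind p x) * \prod_(q <- D) ind q x));
  last by move=> x _; rewrite big_cons; ring.
rewrite big_cons [v * (_ * _)]mulrA; congr (_ <= _).
by field; rewrite !gt_eqF.
Qed.

Hypothesis E_ge0 : 0 <= E.

Lemma sieve_approx1 B : equidistributed B -> sieve_approx B (fun=> 1) 1 1 1.
Proof.
move=> equiB D uD pD DB; rewrite mulr1 mul1r => DY.
rewrite [X in `|X - _|](eq_bigr (fun x => g x * \prod_(p <- D) ind p x)); last first.
  by move=> x _; rewrite mulr1.
apply: le_trans (equiB D uD pD DB DY) _.
by rewrite mulr1 ler_peMr // exprn_ege1 // ler_pdivlMr ?modulus_gt0 // mul1r.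
Qed.

Lemma sieve_approxW B B' F v w w' Q Q' : {subset B <= B'} -> w <= w' -> Q <= Q' ->
  sieve_approx B F v w Q -> sieve_approx B' F v w' Q'.
Proof.
move=> subB lew leQ approxF D uD pD DB DQ.
apply: le_trans (approxF D uD pD _ _) _.
- by move=> p /DB; apply: contra; apply: subB.
- by apply: le_trans DQ; rewrite ler_wpM2l ?modulus_ge0.
- by rewrite ler_wpM2r ?sqr_ge0 // ler_wpM2l.
Qed.

Variable theta : R.
Hypothesis theta_ge0 : 0 <= theta.

Lemma sieve_approx_elem_sym B F v w Q z s k : 0 <= Q -> 1 <= z -> uniq s -> all prime s ->
  {in s, forall p, p \notin B} -> {in s, forall p, p%:R <= z} ->
  sieve_approx B F v w Q ->
  sieve_approx (s ++ B) (fun x => F x * elem_sym (fun p => theta * ind p x) k s)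
    (v * elem_sym (fun p => theta * eta p) k s)
    (w * elem_sym (fun p => theta / p%:R ^+ 2) k s) (Q * z ^+ k).
Proof.
move=> Q0 z1; elim: s k => [|p s IH] [|k] us ps sB sz approxF.
- by rewrite expr0 mulr1; apply: eq_sieve_approx approxF => [x||] /=; rewrite mulr1.
- by apply: eq_sieve_approx (@sieve_approx0 B _) => [x||] /=; rewrite mulr0.
- rewrite expr0 mulr1.
  apply: (@eq_sieve_approx _ F _ v _ w) => [x|||] /=; rewrite ?mulr1 //.
  by apply: sieve_approxW approxF => // q qB; rewrite -cat_cons mem_cat qB orbT.
move: us ps => /= /andP[pNs us] /andP[pp ps].
have [[pB {}sB] [pz {}sz]] := (iffLR forall_cons sB, iffLR forall_cons sz).
have pNsB : p \notin s ++ B by rewrite mem_cat negb_or pNs.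
have without_p := IH k.+1 us ps sB sz approxF.
have with_p := sieve_approxZ theta (sieve_approxM_ind pp pNsB (IH k us ps sB sz approxF)).
have leQ : Q * z ^+ k * p%:R <= Q * z ^+ k.+1.
  by rewrite exprSr -!mulrA ler_wpM2l // ler_wpM2l // exprn_ge0 // (le_trans ler01).
have sub_cons : {subset s ++ B <= p :: s ++ B} by move=> q qB; rewrite inE qB orbT.
have := sieve_approxD (sieve_approxW sub_cons (lexx _) (lexx _) without_p)
  (sieve_approxW (fun q => id) (lexx _) leQ with_p).
by apply: eq_sieve_approx => [x||] /=; rewrite ?ger0_norm //; ring.
Qed.

Lemma sieve_approx_bonferroni B F v w Q z s k : 0 <= Q -> 1 <= z -> uniq s -> all prime s ->
  {in s, forall p, p \notin B} -> {in s, forall p, p%:R <= z} ->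
  sieve_approx B F v w Q ->
  sieve_approx (s ++ B) (fun x => F x * bonferroni (fun p => theta * ind p x) k s)
    (v * bonferroni (fun p => theta * eta p) k s)
    (w * \sum_(i < k.+1) elem_sym (fun p => theta / p%:R ^+ 2) i s) (Q * z ^+ k).
Proof.
move=> Q0 z1 us ps sB sz approxF.
have approx_elem i := sieve_approx_elem_sym (k := i) Q0 z1 us ps sB sz approxF.
elim: k => [|k IH].
  apply: eq_sieve_approx (approx_elem 0%N) => [x||];
    by rewrite ?bonferroni0 ?big_ord_recl ?big_ord0 ?addr0 ?elem_sym0.
have leQ : Q * z ^+ k <= Q * z ^+ k.+1 by rewrite ler_wpM2l // ler_weXn2l.
have := sieve_approxD (sieve_approxW (fun q => id) (lexx _) leQ IH)
  (sieve_approxZ ((-1) ^+ k.+1) (approx_elem k.+1)).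
apply: eq_sieve_approx => [x||] /=; rewrite ?bonferroniS; [ring|ring|].
by rewrite [in RHS]big_ord_recr /= normrX normrN1 expr1n; ring.
Qed.

Definition hooley_approx B ls w Q : Prop :=
  sieve_approx B (fun x => hooley_up (fun p => theta * ind p x) ls)
    (hooley_up (fun p => theta * eta p) ls) w Q /\
  sieve_approx B (fun x => hooley_lo (fun p => theta * ind p x) ls)
    (hooley_lo (fun p => theta * eta p) ls) w Q.

Lemma hooley_approx_cons B ls w Q z s k : 0 <= w -> 0 <= Q -> 1 <= z ->
  uniq s -> all prime s ->
  {in s, forall p, p \notin B} -> {in s, forall p, p%:R <= z} ->
  hooley_approx B ls w Q ->
  hooley_approx (s ++ B) ((s, k) :: ls)
    (w * \prod_(p <- s) (1 + theta / p%:R ^+ 2)) (Q * z ^+ k.+1).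
Proof.
move=> w0 Q0 z1 us ps sB sz [approx_up approx_lo].
have inv_sqr_ge0 : {in s, forall p, 0 <= theta / p%:R ^+ 2}.
  by move=> p _; rewrite divr_ge0 ?exprn_ge0.
have := ler_wpM2l w0 (sum_elem_sym_le k.+1 inv_sqr_ge0).
rewrite big_ord_recr /= mulrDr => weight_le.
have leQ : Q * z ^+ k <= Q * z ^+ k.+1 by rewrite ler_wpM2l // ler_weXn2l.
have up_bonf := sieve_approx_bonferroni (k := k) Q0 z1 us ps sB sz approx_up.
have lo_bonf := sieve_approx_bonferroni (k := k) Q0 z1 us ps sB sz approx_lo.
have up_elem := sieve_approx_elem_sym (k := k.+1) Q0 z1 us ps sB sz approx_up.
split.
  apply: sieve_approxW (fun=> id) _ leQ up_bonf; apply: le_trans weight_le.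
  by rewrite lerDl mulr_ge0 // elem_sym_ge0.
apply: sieve_approxW (fun=> id) weight_le (lexx _) _.
have := sieve_approxD (sieve_approxW (fun=> id) (lexx _) leQ lo_bonf)
  (sieve_approxZ (-1) up_elem).
by apply: eq_sieve_approx => [x||] /=; rewrite ?mulN1r ?normrN1 ?mul1r.
Qed.

End Equidistribution.

Section DyadicLayers.
Context {R : realType}.
Implicit Types (D : seq nat) (l : R) (J k : nat).

Definition layer D l : seq nat :=
  [seq p <- primes_between (expR (l / 2)) (expR l) | p \notin D].

Fixpoint layers D J l k : seq (seq nat * nat) :=
  if J is J'.+1 then (layer D l, k) :: layers D J' (l / 2) k.+2 else [::].

(* [2 * k + 6] is the sum of [(k + 2 * j + 1) / 2 ^ j] over [j >= 0]. *)
Definition sieve_level k l : R := expR (l * (2 * k + 6)%:R).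

Lemma sieve_level_ge1 k l : 0 <= l -> 1 <= sieve_level k l.
Proof. by move=> l0; rewrite -expR0 ler_expR mulr_ge0. Qed.

Lemma sieve_levelSS k l :
  sieve_level k.+2 (l / 2) * expR l ^+ k.+1 = sieve_level k l.
Proof.
rewrite -expRM_natr -expRD; congr expR.
by rewrite !natrD !natrM -[k.+2]addn2 -[k.+1]addn1 !natrD; field.
Qed.

Lemma mem_layer D l p : (p \in layer D l) =
  [&& p \notin D, expR (l / 2) < p%:R, prime p & p%:R <= expR l].
Proof. by rewrite mem_filter mem_primes_between. Qed.

Lemma all_prime_layer D l : all prime (layer D l).
Proof. by apply/allP => p; rewrite mem_layer => /and4P[]. Qed.

Lemma layer_uniq D l : uniq (layer D l).
Proof. exact: filter_uniq (primes_between_uniq _ _). Qed.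

Lemma mem_layers D J l k sk : sk \in layers D J l k ->
  exists j, sk = (layer D (l / 2 ^+ j), (k + j.*2)%N).
Proof.
elim: J l k => //= J IH l k; rewrite inE => /predU1P[->|/IH[j ->]].
  by exists 0%N; rewrite divr1 addn0.
by exists j.+1; rewrite exprS invfM mulrA doubleS !addSnnS.
Qed.

Lemma layers_even D J l k : ~~ odd k -> all (fun sk => ~~ odd sk.2) (layers D J l k).
Proof.
by move=> even_k; apply/allP => sk /mem_layers[j ->]; rewrite oddD odd_double addbF.
Qed.

Lemma sum_layers_le D J l k :
  \sum_(sk <- layers D J l k) (2 ^+ sk.2)^-1 <= 2 * (2 ^+ k)^-1 :> R.
Proof.
elim: J l k => [|J IH] l k /=; first by rewrite big_nil mulr_ge0 // invr_ge0 exprn_ge0.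
rewrite big_cons /=; apply: le_trans (lerD (lexx _) (IH (l / 2) k.+2)) _.
have : 0 <= (2 ^+ k)^-1 :> R by rewrite invr_ge0 exprn_ge0.
by rewrite !exprS !invfM; lra.
Qed.

Lemma mem_layers_support D J l k p : 0 <= l ->
  p \in layers_support (layers D J l k) -> [&& p \notin D, prime p & p%:R <= expR l].
Proof.
elim: J l k => //= J IH l k l0; rewrite /layers_support /= mem_cat mem_layer.
move=> /orP[/and4P[-> _ -> ->] //|/IH].
case/(_ ltac:(lra))/and3P => -> -> pl; apply: le_trans pl _.
by rewrite ler_expR; lra.
Qed.

Lemma perm_layers_support D J l k : 0 <= l -> l < ln 2 * 2 ^+ J ->
  perm_eq (layers_support (layers D J l k)) [seq p <- primes_upto (expR l) | p \notin D].
Proof.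
elim: J l k => [|J IH] l k l0 lJ.
  rewrite mulr1 in lJ; rewrite primes_upto_lt2 //.
  by rewrite -[ltRHS]lnK ?posrE ?ltr_expR.
have half_le : expR (l / 2) <= expR l by rewrite ler_expR; lra.
rewrite exprS in lJ; rewrite (primes_upto_cat half_le) filter_cat perm_sym perm_catC.
by rewrite /layers_support /= perm_cat2l perm_sym IH //; lra.
Qed.

End DyadicLayers.

Section LayersApprox.
Context {R : realType} {A : Type}.
Variables (X : seq A) (g : A -> R) (ind : nat -> A -> R) (eta : nat -> R).
Variables (M E Y theta : R) (D : seq nat).
Hypotheses (E_ge0 : 0 <= E) (theta_ge0 : 0 <= theta).

Lemma hooley_approx_layers J l k : 0 <= l ->
  equidistributed X g ind eta M E Y D ->
  hooley_approx X g ind eta M E Y theta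
    (layers_support (layers D J l k) ++ D) (layers D J l k)
    (\prod_(p <- layers_support (layers D J l k)) (1 + theta / p%:R ^+ 2))
    (sieve_level k l).
Proof.
move=> l0 equiD; elim: J l k l0 => [|J IH] l k l0.
  rewrite /layers_support big_nil /=.
  have approx1 : sieve_approx X g ind eta M E Y D (fun=> 1) 1 1 (sieve_level k l).
    by apply: sieve_approxW (sieve_approx1 E_ge0 equiD) => //; apply: sieve_level_ge1.
  by split.
have half_l0 : 0 <= l / 2 by rewrite divr_ge0.
rewrite /layers_support /= big_cat /= [\prod_(p <- layer D l) _ * _]mulrC -catA.
rewrite -sieve_levelSS.
apply: hooley_approx_cons => //.
- by apply: prodr_ge0 => p _; rewrite addr_ge0 // divr_ge0 // exprn_ge0.
- exact: expR_ge0.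
- by rewrite -expR0 ler_expR.
- exact: layer_uniq.
- exact: all_prime_layer.
- move=> p; rewrite mem_layer mem_cat negb_or => /and4P[-> ltp _ _]; rewrite andbT.
  apply/negP => /(mem_layers_support half_l0)/and3P[_ _].
  by rewrite leNgt ltp.
- by move=> p; rewrite mem_layer => /and4P[].
- exact: IH.
Qed.

End LayersApprox.

Section BrunHooleySieve.
Context {R : realType}.
Implicit Types (theta t L l : R) (eta : nat -> R) (D s : seq nat) (k : nat).

Lemma expR_le_1sub theta t : 0 <= theta < 1 -> 0 <= t <= 1 ->
  expR (- (t / (1 - theta))) <= 1 - theta * t.
Proof.
move=> /andP[theta0 theta1] /andP[t0 t1].
have theta_t : theta * t <= theta by rewrite ler_piMr.
have denom_gt0 : 0 < 1 - theta by lra.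
have u_gt0 : 0 < 1 - theta * t by lra.
apply: le_trans (expR_1subV_le u_gt0); rewrite ler_expR.
have -> : 1 - (1 - theta * t)^-1 = - (theta * t / (1 - theta * t)).
  by field; rewrite gt_eqF.
rewrite lerN2 ler_pM ?mulr_ge0 ?invr_ge0 ?(ltW u_gt0) //; first by rewrite ler_piMl // ltW.
by rewrite lef_pV2 ?posrE // lerD2l lerN2.
Qed.

Lemma scaled_prob theta t : 0 <= theta < 1 -> 0 <= t <= 1 -> 0 <= theta * t <= 1.
Proof. by move=> /andP[? /ltW ?] /andP[? ?]; rewrite mulr_ge0 //= mulr_ile1. Qed.

Lemma prod_1sub_ge_expR theta L eta s : 0 <= theta < 1 ->
  {in s, forall p, 0 <= eta p <= 1} -> \sum_(p <- s) eta p <= L ->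
  expR (- (L / (1 - theta))) <= \prod_(p <- s) (1 - theta * eta p).
Proof.
move=> theta01 eta01 sumL; have [theta0 theta1] := andP theta01.
apply: le_trans (_ : _ <= \prod_(p <- s) expR (- (eta p / (1 - theta)))) _.
  rewrite -expR_sum ler_expR sumrN -big_distrl /= lerN2 ler_wpM2r //.
  by rewrite invr_ge0 subr_ge0 ltW.
by apply: ler_prod_seq => p /eta01 ? _; rewrite expR_ge0 expR_le_1sub.
Qed.

(* The number of terms kept in the top layer; the deeper layers keep more. *)
Definition sieve_depth theta L k : Prop :=
  [/\ ~~ odd k, (1 < k)%N & expR (4 * L + L / (1 - theta)) <= 2 ^+ k].

Lemma exists_sieve_depth theta L : exists k, sieve_depth theta L k.
Proof.
have [n lt_n] := exists_pow2_gt (expR (4 * L + L / (1 - theta))).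
exists n.+1.*2; split; [by rewrite odd_double|by rewrite doubleS|].
by apply: le_trans (ltW lt_n) _; rewrite ler_weXn2l ?ler1n //; lia.
Qed.

Section LayerMass.
Variables (theta L : R) (eta : nat -> R) (k : nat).
Hypotheses (theta01 : 0 <= theta < 1) (eta_prob : prob_on_primes eta).
Hypothesis k_depth : sieve_depth theta L k.
Hypothesis dyadic_mass : dyadic_mass_le L eta.

Let layer_prob D l : {in layer D l, forall p, 0 <= eta p <= 1}.
Proof. by move=> p; rewrite mem_layer => /and4P[_ _ /eta_prob]. Qed.

Lemma sum_layer_le D l : 0 <= l -> \sum_(p <- layer D l) eta p <= L.
Proof.
move=> l0; apply: le_trans (dyadic_mass l0); rewrite big_filter.
by apply: ler_sum_seq_sub => // p; rewrite mem_primes_between => /and3P[_ /eta_prob/andP[]].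
Qed.

Lemma elem_sym_layer_le D l j : 0 <= l ->
  elem_sym (fun p => theta * eta p) (k + j.*2).+1 (layer D l) <=
  (2 ^+ (k + j.*2))^-1 * bonferroni (fun p => theta * eta p) (k + j.*2) (layer D l).
Proof.
move=> l0; have [even_k _ k_large] := k_depth; have [theta0 theta1] := andP theta01.
have massL := sum_layer_le D l0.
apply: (elem_sym_le_bonferroni _ _ _ (prod_1sub_ge_expR theta01 (@layer_prob _ _) massL)).
- by rewrite oddD odd_double addbF.
- by move=> p /layer_prob; apply: scaled_prob.
- apply: le_trans massL; apply: ler_sum_seq => p /layer_prob/andP[eta0 _] _.
  by rewrite ler_piMl // ltW.
- by apply: le_trans k_large _; rewrite ler_weXn2l ?ler1n // leq_addr.
Qed.

Lemma hooley_lo_layers_ge D J l : 0 <= l -> l < ln 2 * 2 ^+ J ->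
  1 / 2 * \prod_(p <- primes_upto (expR l) | p \notin D) (1 - theta * eta p)
    <= hooley_lo (fun p => theta * eta p) (layers D J l k).
Proof.
move=> l0 lJ; have [even_k k_gt1 _] := k_depth.
have even_layers := layers_even D J l even_k.
have y01 : {in layers_support (layers D J l k), forall p, 0 <= theta * eta p <= 1}.
  by move=> p /(mem_layers_support l0)/and3P[_ /eta_prob]; move/(scaled_prob theta01).
have rem_le : {in layers D J l k, forall sk,
    elem_sym (fun p => theta * eta p) sk.2.+1 sk.1
    <= (2 ^+ sk.2)^-1 * bonferroni (fun p => theta * eta p) sk.2 sk.1}.
  by move=> sk /mem_layers[j ->]; apply: elem_sym_layer_le; rewrite divr_ge0 ?exprn_ge0.
apply: le_trans (hooley_lo_ge even_layers y01 rem_le).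
rewrite -big_filter -(perm_big _ (perm_layers_support D k l0 lJ)) /=.
apply: ler_pM; [by []|exact: prod_1sub_ge0 y01| |exact: hooley_up_ge].
have : (2 ^+ k)^-1 <= 4^-1 :> R.
  rewrite lef_pV2 ?posrE ?exprn_gt0 //; have -> : 4 = 2 ^+ 2 :> R by rewrite expr2; lra.
  by rewrite ler_weXn2l ?ler1n.
by have := sum_layers_le D J l k; lra.
Qed.

End LayerMass.

Lemma brun_hooley_lower_bound (A : Type) (X : seq A) (g : A -> R) (ind : nat -> A -> R)
    (eta : nat -> R) (M E theta L l : R) D k :
  0 <= M -> 0 <= E -> 0 <= l -> 0 <= theta < 1 -> prob_on_primes eta ->
  sieve_depth theta L k -> dyadic_mass_le L eta ->
  (forall x, 0 <= g x) -> (forall p x, 0 <= ind p x <= 1) ->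
  equidistributed X g ind eta M E (sieve_level k l) D ->
  M / 2 * \prod_(p <- primes_upto (expR l) | p \notin D) (1 - theta * eta p)
    - E * expR (2 * theta) * sieve_level k l ^+ 2
  <= \sum_(x <- X) g x *
       \prod_(p <- primes_upto (expR l) | p \notin D) (1 - theta * ind p x).
Proof.
move=> M0 E0 l0 theta01 eta_prob k_depth dyadic_mass g0 ind01 equiD.
have [theta0 _] := andP theta01; have [even_k _ _] := k_depth.
have [J ltJ] := exists_pow2_gt (l / ln 2).
have {}ltJ : l < ln 2 * 2 ^+ J by rewrite mulrC -ltr_pdivrMr // ln2_gt0.
set ls := layers D J l k; set Y := sieve_level k l.
have lo_eta := hooley_lo_layers_ge theta01 eta_prob k_depth dyadic_mass D l0 ltJ.
have lo_ind : \sum_(x <- X) g x * hooley_lo (fun p => theta * ind p x) ls <=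
    \sum_(x <- X) g x *
      \prod_(p <- primes_upto (expR l) | p \notin D) (1 - theta * ind p x).
  apply: ler_sum => x _; apply: ler_wpM2l => //.
  rewrite -big_filter -(perm_big _ (perm_layers_support D k l0 ltJ)).
  apply: hooley_lo_le; first exact: layers_even even_k.
  by move=> p _; apply: scaled_prob.
apply: le_trans lo_ind.
have [_ /sieve_approx_total] := hooley_approx_layers E0 theta0 J k l0 equiD.
move=> /(_ (lexx _)); rewrite -/ls -/Y; set w := \prod_(p <- layers_support ls) _.
have w_le : w <= expR (2 * theta).
  rewrite /w (perm_big _ (perm_layers_support D k l0 ltJ)) big_filter.
  apply: le_trans (prod_primes_inv_sqr_le (expR l) theta0).
  rewrite [leRHS](bigID (fun p => p \notin D)) /= ler_peMr //.
    by apply: prodr_ge0 => p _; rewrite addr_ge0 // divr_ge0 // exprn_ge0.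
  by apply: prodr_ge1_seq => p _ _; rewrite lerDl divr_ge0 // exprn_ge0.
have Ew_le : E * w * Y ^+ 2 <= E * expR (2 * theta) * Y ^+ 2.
  by rewrite ler_wpM2r ?exprn_ge0 ?expR_ge0 // ler_wpM2l.
rewrite ler_norml => /andP[approx_lo_ge _].
by have := ler_wpM2l M0 lo_eta; lra.
Qed.

End BrunHooleySieve.

Section SquarefreeProducts.
Implicit Types (D : seq nat).

Lemma prod_primes_gt0 D : all prime D -> (0 < \prod_(p <- D) p)%N.
Proof.
by move=> /allP pD; rewrite big_seq; apply: prodn_cond_gt0 => p /pD/prime_gt0.
Qed.

Lemma logn_prod_primes D q : uniq D -> all prime D ->
  logn q (\prod_(p <- D) p) = (q \in D).
Proof.
elim: D => [|p D IH] /=; first by rewrite big_nil logn1.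
case/andP=> pD uD /andP[pp aD]; rewrite big_cons.
rewrite (lognM _ (prime_gt0 pp) (prod_primes_gt0 aD)).
by rewrite logn_prime // IH // inE; case: eqP => [->|//]; rewrite (negbTE pD).
Qed.

Lemma mem_primes_prod D : all prime D -> primes (\prod_(p <- D) p) =i D.
Proof.
elim: D => [|p D IH] /=; first by rewrite big_nil.
case/andP=> pp aD q; rewrite big_cons.
rewrite (primesM _ (prime_gt0 pp) (prod_primes_gt0 aD)) IH //.
by rewrite primes_prime // !inE.
Qed.

Lemma squarefree_prod D : uniq D -> all prime D -> squarefree (\prod_(p <- D) p).
Proof.
move=> uD aD; rewrite /squarefree prod_primes_gt0 //=; apply/allP => q _.
by rewrite logn_prod_primes // leq_b1.
Qed.

Lemma coprime_prod_primes D D' : uniq (D ++ D') -> all prime D -> all prime D' ->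
  coprime (\prod_(p <- D) p) (\prod_(p <- D') p).
Proof.
rewrite cat_uniq => /and3P[_ /hasPn disjoint _] aD aD'.
rewrite coprime_has_primes ?prod_primes_gt0 //; apply/hasPn => q.
by rewrite !mem_primes_prod // => /disjoint.
Qed.

Lemma mult01_prod {R : realType} (eta : nat -> R) D : mult01 eta -> uniq D ->
  all prime D -> eta (\prod_(p <- D) p)%N = \prod_(p <- D) eta p.
Proof.
move=> [eta1 [etaM _]]; elim: D => [|p D IH]; first by rewrite !big_nil.
move=> uD /andP[pp aD]; rewrite !big_cons.
rewrite (etaM _ _ (prime_gt0 pp) (prod_primes_gt0 aD)).
  by rewrite IH //; case/andP: uD.
have := @coprime_prod_primes [:: p] D uD; rewrite big_seq1 /= pp; exact.
Qed.

Lemma mult01_prob {R : realType} (eta : nat -> R) : mult01 eta -> prob_on_primes eta.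
Proof. by move=> [_ [_ eta01]] p pp; apply/eta01/prime_gt0. Qed.

End SquarefreeProducts.

Section SignIndicators.
Context {R : realType} {A : eqType}.
Implicit Types (X : seq A) (f : nat -> A -> int) (x : A) (e : int) (D : seq nat).
Implicit Types (K Y : R) (etap etam : nat -> R).

Definition sign_ind f e (p : nat) x : R := (f p x == e)%:R.

Lemma sign_ind_ge0 f e p x : 0 <= sign_ind f e p x.
Proof. exact: ler0n. Qed.

Lemma sign_ind01 f e p x : 0 <= sign_ind f e p x <= 1.
Proof. by rewrite sign_ind_ge0 lern1 leq_b1. Qed.

Lemma prod_sign_ind f e D x :
  \prod_(p <- D) sign_ind f e p x = (all (fun p => f p x == e) D)%:R.
Proof.
elim: D => [|p D IH]; first by rewrite big_nil.
by rewrite big_cons IH /sign_ind -natrM mulnb.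
Qed.

Lemma count_signE X f Dm Dp : all prime Dm -> all prime Dp ->
  (count_sign X f (\prod_(p <- Dm) p) (\prod_(p <- Dp) p))%:R =
  \sum_(x <- X) \prod_(p <- Dp) sign_ind f 1 p x * \prod_(p <- Dm) sign_ind f (-1) p x.
Proof.
move=> am ap; rewrite /count_sign size_filter -sum1_count natr_sum big_mkcond /=.
apply: eq_bigr => x _; rewrite !prod_sign_ind -natrM mulnb andbC.
rewrite !(eq_all_r (mem_primes_prod _)) //.
by case: (_ && _).
Qed.

Definition sign_equidistributed X f etap etam K Y : Prop := forall Dm Dp,
  uniq (Dm ++ Dp) -> all prime Dm -> all prime Dp -> modulus Dm * modulus Dp <= Y ->
  `| \sum_(x <- X) \prod_(p <- Dp) sign_ind f 1 p x * \prod_(p <- Dm) sign_ind f (-1) p x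
     - (size X)%:R * \prod_(p <- Dp) etap p * \prod_(p <- Dm) etam p |
  <= (size X)%:R * K.

Lemma count_sign_equidistributed X f etap etam K Y :
  (0 < size X)%N -> mult01 etap -> mult01 etam ->
  (forall qm qp : nat, squarefree qm -> squarefree qp -> coprime qm qp ->
    (qm * qp)%N%:R <= Y ->
    `| (count_sign X f qm qp)%:R / (size X)%:R - etam qm * etap qp | <= K) ->
  sign_equidistributed X f etap etam K Y.
Proof.
move=> X_gt0 multp multm count_le Dm Dp uD am ap DY.
have sizeX_gt0 : 0 < (size X)%:R :> R by rewrite ltr0n.
have [um up] : uniq Dm /\ uniq Dp by move: uD; rewrite cat_uniq => /and3P[].
have := count_le _ _ (squarefree_prod um am) (squarefree_prod up ap)
  (coprime_prod_primes uD am ap).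
rewrite natrM !natr_prod => /(_ DY); rewrite count_signE // !mult01_prod //.
rewrite -(ler_pM2l sizeX_gt0) -{1}[(size X)%:R](@ger0_norm R) // -normrM.
set S := \sum_(x <- _) _; congr (`| _ | <= _).
by field; rewrite gt_eqF.
Qed.

Section SignEquidistribution.
Variables (X : seq A) (f : nat -> A -> int) (etap etam : nat -> R) (K Y : R).
Hypothesis signX : sign_equidistributed X f etap etam K Y.

Lemma plus_equidistributed :
  equidistributed X (fun=> 1) (sign_ind f 1) etap (size X)%:R ((size X)%:R * K) Y [::].
Proof.
move=> D uD pD _ DY; have := @signX [::] D uD isT pD.
rewrite modulus_nil mul1r big_nil mulr1 => /(_ DY).
by rewrite (eq_bigr (fun x => 1 * \prod_(p <- D) sign_ind f 1 p x)) // => x _;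
  rewrite big_nil mulr1 mul1r.
Qed.

Lemma minus_equidistributed D Y' : uniq D -> all prime D -> Y' * modulus D <= Y ->
  equidistributed X (fun x => \prod_(p <- D) sign_ind f 1 p x) (sign_ind f (-1)) etam
    ((size X)%:R * \prod_(p <- D) etap p) ((size X)%:R * K) Y' D.
Proof.
move=> uD pD DY D' uD' pD' disjoint D'Y'; apply: signX => //.
  by rewrite cat_uniq uD' uD andbT /=; apply/hasPn => p; apply: contraL => /disjoint.
by apply: le_trans DY; rewrite ler_wpM2r // modulus_ge0.
Qed.

End SignEquidistribution.

End SignIndicators.

Section EulerWeight.
Context {R : realType} {A : eqType}.
Implicit Types (X : seq A) (f : nat -> A -> int) (x : A) (e : int) (s : seq nat).
Implicit Types (alpha z t u : R).

Definition sign_valued f : Prop := forall p x, prime p -> f p x \in [:: -1; 0; 1].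

Definition supp_bounded X f z : Prop :=
  {in X, forall x n, partial_supp_prod f x n <= z}.

Definition euler_prod alpha f z x : R := \prod_(p <- primes_upto z) alpha ^ f p x.

Lemma exprz_sign alpha f p x : sign_valued f -> prime p ->
  alpha ^ f p x =
  (1 + (alpha - 1) * sign_ind f 1 p x) * (1 - (1 - alpha^-1) * sign_ind f (-1) p x).
Proof.
move=> f_sign pp; have := f_sign p x pp.
rewrite /sign_ind !inE => /or3P[] /eqP -> /=.
- by rewrite exprN1; ring.
- by rewrite expr0z; ring.
- by rewrite expr1z; ring.
Qed.

Lemma exprz_sign_le alpha f p x : 1 < alpha -> sign_valued f -> prime p ->
  alpha ^ f p x <= 1 + (alpha - 1) * sign_ind f 1 p x.
Proof.
move=> alpha1 f_sign pp; rewrite exprz_sign //.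
have ind_ge0 := @sign_ind_ge0 R A f 1 p x; rewrite ler_piMr //.
  by rewrite addr_ge0 // mulr_ge0 // subr_ge0 ltW.
by rewrite gerBl mulr_ge0 ?sign_ind_ge0 // subr_ge0 invf_le1 ?ltW //; lra.
Qed.

Lemma exprz_sign_ge alpha f p x : 1 < alpha -> sign_valued f -> prime p ->
  (if f p x == -1 then alpha^-1 else 1) <= alpha ^ f p x.
Proof.
move=> alpha1 f_sign pp; have := f_sign p x pp.
by rewrite !inE => /or3P[] /eqP -> //=; rewrite ?exprN1 ?expr0z ?expr1z // ltW.
Qed.

Lemma prime_in_supp_le f x z p : (forall n, partial_supp_prod f x n <= z) -> prime p ->
  f p x != 0 -> p%:R <= z.
Proof.
move=> supp_le pp fp; apply: le_trans (supp_le p.+1); rewrite /partial_supp_prod.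
rewrite big_mkcond big_ord_recr /= pp fp ler_peMl //.
apply: prodr_ge1_seq => i _ _; case: ifP => // /andP[ip _].
by rewrite ler1n prime_gt0.
Qed.

Lemma sign_modulus_le f x z e : e != 0 -> (forall n, partial_supp_prod f x n <= z) ->
  modulus [seq p <- primes_upto z | f p x == e] <= z.
Proof.
move=> e_neq0 supp_le.
apply: le_trans (_ : _ <= modulus [seq p <- primes_upto z | f p x != 0]) _.
  apply: modulus_subseq; first exact: all_prime_filter_primes_upto.
  rewrite subseq_filter filter_subseq andbT; apply/allP => p.
  by rewrite mem_filter => /andP[/eqP ->].
apply: le_trans (supp_le (Num.truncn z).+1); rewrite /modulus -filter_predI big_filter.
rewrite /partial_supp_prod -(big_mkord (fun p => prime p && (f p x != 0))).
rewrite /index_iota subn0.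
by rewrite (eq_bigl (fun p => prime p && (f p x != 0))) // => p; rewrite andbC.
Qed.

Lemma euler_weightE alpha f x z : (forall n, partial_supp_prod f x n <= z) ->
  euler_weight alpha f x = euler_prod alpha f z x.
Proof.
move=> supp_le; apply: norm_lim_near_cst.
exists (Num.truncn z).+1 => // n /= zn; rewrite /partial_weight.
rewrite -(big_mkord prime (fun p => alpha ^ f p x)) /index_iota subn0.
rewrite /euler_prod big_filter -(subnKC zn) iotaD big_cat /= [X in _ * X]big_seq_cond [X in _ * X]big1 ?mulr1 //.
move=> p; rewrite mem_iota add0n => /andP[/andP[zp _] pp].
suff -> : f p x = 0 by rewrite expr0z.
apply/eqP; apply: contraTT zp => /(prime_in_supp_le supp_le pp) pz.
rewrite -leqNgt truncn_ge_nat //; exact: le_trans pz.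
Qed.

Lemma sum_euler_weightE alpha X f z : supp_bounded X f z ->
  \sum_(x <- X) euler_weight alpha f x = \sum_(x <- X) euler_prod alpha f z x.
Proof.
move=> suppX; rewrite big_seq [RHS]big_seq.
by apply: eq_bigr => x /suppX/euler_weightE.
Qed.

(* At most [u / t] primes exceeding [expR t] divide a modulus bounded by [expR u]. *)
Lemma prod_exprz_sign_ge alpha f x t u s : 1 < alpha -> sign_valued f -> 0 < t ->
  all prime s -> all (fun p => expR t < p%:R) s ->
  modulus [seq p <- s | f p x == -1] <= expR u ->
  alpha `^ (- (u / t)) <= \prod_(p <- s) alpha ^ f p x.
Proof.
move=> alpha1 f_sign t0 /allP ps st su; have alpha_ge0 : 0 <= alpha by lra.
apply: le_trans (_ : _ <= \prod_(p <- s | f p x == -1) alpha^-1) _; last first.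
  rewrite big_mkcond /=; apply: ler_prod_seq => p /ps pp _.
  by rewrite exprz_sign_ge // andbT; case: ifP; rewrite ?invr_ge0.
rewrite prodr_const_seq exprVn powRN lef_pV2 ?posrE ?exprn_gt0 ?powR_gt0 //; try lra.
rewrite -size_filter expn_size_le_powR ?(ltW alpha1) //.
apply/allP => p; rewrite mem_filter => /andP[_]; exact: (allP st).
Qed.

End EulerWeight.

Section RankinSum.
Context {R : realType}.
Implicit Types (alpha k z t r Q : R) (chi : nat -> R).
Implicit Types (p j J : nat) (a b S : seq nat).

Definition rankin_weight alpha k p : R := alpha * p%:R `^ k - 1.

Definition rankin_sum alpha k Q z chi : R :=
  trunc_euler_prod (primes_upto z) Q (fun p => rankin_weight alpha k p * chi p).

Lemma rankin_weight_ge0 alpha k p : 1 <= alpha -> 0 <= k -> prime p ->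
  0 <= rankin_weight alpha k p.
Proof.
move=> alpha1 k0 pp; rewrite subr_ge0 -[leLHS]mulr1.
by rewrite ler_pM // powR_prime_ge1.
Qed.

Lemma rankin_sum_ge0 alpha k Q z chi : 1 <= alpha -> 0 <= k -> (forall p, 0 <= chi p) ->
  0 <= rankin_sum alpha k Q z chi.
Proof.
move=> alpha1 k0 chi0; apply: trunc_euler_prod_ge0 => p.
by rewrite mem_primes_upto => /andP[pp _]; rewrite mulr_ge0 // rankin_weight_ge0.
Qed.

Lemma expn_size_le_rankin_sum alpha k Q z chi a : 1 <= alpha -> 0 <= k ->
  (forall p, 0 <= chi p) -> {in a, forall p, chi p = 1} ->
  sorted ltn a -> all prime a -> all (fun p => p%:R <= z) a -> modulus a <= Q ->
  alpha ^+ size a * modulus a `^ k <= rankin_sum alpha k Q z chi.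
Proof.
move=> alpha1 k0 chi0 chi1 sorted_a pa az aQ.
apply: le_trans (trunc_euler_prod_ge _ pa (subseq_primes_upto sorted_a pa az) aQ).
  rewrite -count_predT -prodr_const_seq modulus_powR -big_split /=.
  apply: ler_prod_seq => p ap _; rewrite chi1 // mulr1 subrKC lexx andbT.
  by rewrite mulr_ge0 ?powR_ge0 // (le_trans ler01).
move=> p; rewrite mem_primes_upto => /andP[pp _].
by rewrite mulr_ge0 // rankin_weight_ge0.
Qed.

Lemma modulus_prefix_split S Q : all prime S -> 1 <= Q ->
  modulus S <= Q \/ exists a q b,
    [/\ S = a ++ q :: b, modulus a <= Q & Q < modulus a * q%:R].
Proof.
elim: S Q => [|p S IH] Q /=; first by rewrite modulus_nil; left.
case/andP=> pp pS Q1; have p0 : 0 < p%:R :> R by rewrite ltr0n prime_gt0.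
have [pQ|Qp] := leP p%:R Q; last first.
  by right; exists [::], p, S; rewrite modulus_nil mul1r.
have [|SQ|[a [q [b [-> aQ Qaq]]]]] := IH (Q / p%:R) pS.
- by rewrite ler_pdivlMr // mul1r.
- by left; rewrite modulus_cons mulrC -ler_pdivlMr.
right; exists (p :: a), q, b; rewrite !modulus_cons; split => //.
  by rewrite mulrC -ler_pdivlMr.
by rewrite -mulrA mulrC -ltr_pdivrMr.
Qed.

Lemma dyadic_scale J (x t : R) : x <= t -> t / 2 ^+ J < x ->
  exists2 j, (j < J)%N & t / 2 ^+ j.+1 < x <= t / 2 ^+ j.
Proof.
elim: J => [|J IH] xt tx; first by move: tx; rewrite expr0 divr1 ltNge xt.
have [xtJ|tJx] := leP x (t / 2 ^+ J); first by exists J => //; rewrite tx.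
by have [j jJ tj] := IH xt tJx; exists j => //; rewrite ltnS ltnW.
Qed.

(* The exponent [(2 r ln alpha + 1) 2 ^ j / t] makes a modulus above [expR t] gain
   [alpha ^ (2 r 2 ^ j) * 2 ^ j], which covers the at most [2 r 2 ^ j] primes above the
   scale [expR (t / 2 ^ j.+1)]. *)
Definition rankin_const alpha r : R := 2 * r * ln alpha + 1.

Definition rankin_scale alpha r t j chi : R :=
  rankin_sum alpha (rankin_const alpha r * 2 ^+ j / t)
    (expR (2 * t)) (expR (t / 2 ^+ j)) chi.

Definition rankin_majorant alpha r t J chi : R :=
  alpha `^ r * rankin_sum alpha 0 (expR (2 * t)) (expR (2 * t)) chi
  + \sum_(j < J) (2 ^+ j)^-1 * rankin_scale alpha r t j chi.

Lemma rankin_const_ge0 alpha r : 1 <= alpha -> 0 <= r -> 0 <= rankin_const alpha r.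
Proof. by move=> alpha1 r0; rewrite addr_ge0 // !mulr_ge0 ?ln_ge0. Qed.

Section Majorant.
Variables (alpha r t : R) (chi : nat -> R) (S : seq nat).
Hypotheses (alpha_ge1 : 1 <= alpha) (r_ge0 : 0 <= r) (t_gt0 : 0 < t).
Hypotheses (chi_ge0 : forall p, 0 <= chi p) (chi_eq1 : {in S, forall p, chi p = 1}).
Hypotheses (sortedS : sorted ltn S) (primeS : all prime S).
Hypothesis S_le : modulus S <= expR (r * t).

Let exponent_ge0 j : 0 <= rankin_const alpha r * 2 ^+ j / t.
Proof. by rewrite divr_ge0 ?mulr_ge0 ?rankin_const_ge0 ?exprn_ge0 // ltW. Qed.

Let sum_scales_ge0 J (P : pred 'I_J) :
  0 <= \sum_(j < J | P j) (2 ^+ j)^-1 * rankin_scale alpha r t j chi.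
Proof.
by apply: sumr_ge0 => j _; rewrite mulr_ge0 ?rankin_sum_ge0 // invr_ge0 exprn_ge0.
Qed.

Lemma expn_size_prefix_le k z a b : S = a ++ b -> 0 <= k ->
  all (fun p => p%:R <= z) a -> modulus a <= expR (2 * t) ->
  alpha ^+ size a * modulus a `^ k <= rankin_sum alpha k (expR (2 * t)) z chi.
Proof.
move=> Sab k0 az aQ; have aS : subseq a S by rewrite Sab prefix_subseq.
apply: expn_size_le_rankin_sum => //.
- by move=> p /(mem_subseq aS)/chi_eq1.
- by apply: subseq_sorted aS sortedS; apply: ltn_trans.
- by apply/allP => p /(mem_subseq aS)/(allP primeS).
Qed.

Lemma expn_size_suffix_le (x : R) a b : S = a ++ b -> 0 < x ->
  all (fun p => expR x < p%:R) b -> alpha ^+ size b <= alpha `^ (r * t / x).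
Proof.
move=> Sab x0 xb; apply: expn_size_le_powR => //; apply: le_trans S_le.
by apply: modulus_subseq primeS _; rewrite Sab suffix_subseq.
Qed.

Lemma expn_size_le_of_large_suffix a b : S = a ++ b -> modulus a <= expR (2 * t) ->
  all (fun p => expR t < p%:R) b ->
  alpha ^+ size S <= alpha `^ r * rankin_sum alpha 0 (expR (2 * t)) (expR (2 * t)) chi.
Proof.
move=> Sab aQ tb; rewrite Sab size_cat exprD mulrC.
have := expn_size_suffix_le Sab t_gt0 tb; rewrite mulfK ?gt_eqF // => suffix_le.
have := expn_size_prefix_le (z := expR (2 * t)) Sab (lexx 0) _ aQ.
rewrite powRr0 mulr1 => prefix_le.
apply: ler_pM; rewrite ?exprn_ge0 ?(le_trans ler01) // prefix_le //.
apply/allP => p ap; apply: le_trans aQ; apply: ler_mem_modulus => //.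
by move: primeS; rewrite Sab all_cat => /andP[].
Qed.

Lemma expn_size_le_of_smooth_prefix j a b : S = a ++ b ->
  expR t <= modulus a <= expR (2 * t) ->
  all (fun p => p%:R <= expR (t / 2 ^+ j)) a ->
  all (fun p => expR (t / 2 ^+ j.+1) < p%:R) b ->
  alpha ^+ size S <= (2 ^+ j)^-1 * rankin_scale alpha r t j chi.
Proof.
move=> Sab /andP[ta aQ] az bz; have alpha_gt0 := lt_le_trans ltr01 alpha_ge1.
have pow_gt0 : 0 < 2 ^+ j :> R by rewrite exprn_gt0.
have x_gt0 : 0 < t / 2 ^+ j.+1 by rewrite divr_gt0 ?exprn_gt0.
rewrite ler_pdivlMl //; apply: le_trans (expn_size_prefix_le Sab (exponent_ge0 j) az aQ).
rewrite Sab size_cat exprD mulrCA ler_wpM2l ?exprn_ge0 ?(ltW alpha_gt0) //.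
rewrite [leLHS]mulrC.
have powR_modulus_ge : expR (rankin_const alpha r * 2 ^+ j)
    <= modulus a `^ (rankin_const alpha r * 2 ^+ j / t).
  rewrite -[X in expR X](divfK (lt0r_neq0 t_gt0)) mulrC expRM.
  by rewrite ge0_ler_powR ?nnegrE ?expR_ge0 ?modulus_ge0.
apply: le_trans powR_modulus_ge.
apply: le_trans (_ : _ <= alpha `^ (2 * r * 2 ^+ j) * expR (2 ^+ j)) _.
  apply: ler_pM; rewrite ?exprn_ge0 ?(ltW alpha_gt0) //; last first.
    by apply: le_trans (expR_ge1Dx _); rewrite lerDr.
  have := expn_size_suffix_le Sab x_gt0 bz.
  have -> // : r * t / (t / 2 ^+ j.+1) = 2 * r * 2 ^+ j.
  by rewrite exprS; field; rewrite !gt_eqF.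
rewrite powR_gt0E // -expRD ler_expR.
by have -> : rankin_const alpha r * 2 ^+ j = 2 * r * 2 ^+ j * ln alpha + 2 ^+ j
  by rewrite /rankin_const; ring.
Qed.

Lemma expn_size_le_rankin_majorant J : t / 2 ^+ J < ln 2 ->
  alpha ^+ size S <= rankin_majorant alpha r t J chi.
Proof.
move=> ltJ; have Q_ge1 : 1 <= expR (2 * t) by rewrite -expR0 ler_expR mulr_ge0 // ltW.
have large_suffix a b : S = a ++ b -> modulus a <= expR (2 * t) ->
    all (fun p => expR t < p%:R) b -> alpha ^+ size S <= rankin_majorant alpha r t J chi.
  move=> Sab aQ tb; apply: le_trans (expn_size_le_of_large_suffix Sab aQ tb) _.
  by rewrite lerDl.
have [SQ|[a [q [b [Sab aQ Qaq]]]]] := modulus_prefix_split primeS Q_ge1.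
  by apply: (large_suffix S [::]); rewrite ?cats0.
have pq : prime q by move: primeS; rewrite Sab all_cat /= => /and3P[].
have q_gt0 : 0 < q%:R :> R by rewrite ltr0n prime_gt0.
have : pairwise ltn (a ++ q :: b) by rewrite -Sab -(sorted_pairwise ltn_trans).
rewrite pairwise_cat /= => /and3P[/allrelP a_lt _ /andP[/allP q_lt _]].
have le_q : {in a, forall p, p%:R <= q%:R :> R}.
  by move=> p ap; rewrite ler_nat; apply/ltnW/a_lt; rewrite ?mem_head.
have q_le : {in q :: b, forall p, q%:R <= p%:R :> R}.
  by move=> p; rewrite inE ler_nat => /predU1P[-> //|/q_lt/ltnW].
have [tq|qt] := ltP (expR t) q%:R.
  by apply: (large_suffix _ _ Sab aQ); apply/allP => p /q_le; apply: lt_le_trans.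
have ln2_le : ln 2 <= ln q%:R :> R by rewrite ln2_le_ln // ler_nat prime_gt1.
have [j jJ /andP[scale_lt le_scale]] :=
  dyadic_scale (ln_le_expR q_gt0 qt) (lt_le_trans ltJ ln2_le).
apply: le_trans (_ : _ <= (2 ^+ j)^-1 * rankin_scale alpha r t j chi) _; last first.
  rewrite /rankin_majorant (bigD1 (Ordinal jJ)) //= addrCA lerDl.
  by rewrite addr_ge0 ?sum_scales_ge0 // mulr_ge0 ?powR_ge0 // rankin_sum_ge0.
apply: (expn_size_le_of_smooth_prefix Sab).
- rewrite aQ andbT -(ler_pM2r (expR_gt0 t)) -expRD.
  have -> : t + t = 2 * t by ring.
  by rewrite ltW // (lt_le_trans Qaq) // ler_wpM2l // modulus_ge0.
- apply/allP => p /le_q/le_trans; apply.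
  by rewrite -[leLHS](@lnK R) ?posrE // ler_expR.
- apply/allP => p /q_le; apply: lt_le_trans.
  by rewrite -[ltRHS](@lnK R) ?posrE // ltr_expR.
Qed.

End Majorant.

Lemma sum_rankin_majorant_le (A : Type) (X : seq A) (ind : nat -> A -> R) alpha r t T J :
  1 <= alpha -> 0 <= r -> 0 < t -> 0 <= T ->
  (forall k x, 0 <= k -> 0 <= x <= 2 * t -> k * x <= rankin_const alpha r ->
    \sum_(y <- X) rankin_sum alpha k (expR (2 * t)) (expR x) (ind ^~ y) <= T) ->
  \sum_(y <- X) rankin_majorant alpha r t J (ind ^~ y) <= (alpha `^ r + 2) * T.
Proof.
move=> alpha1 r0 t0 T0 sum_le; have K0 := rankin_const_ge0 alpha1 r0.
rewrite /rankin_majorant big_split /= -big_distrr.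
rewrite [\sum_(y <- X) \sum_(j < J) _]exchange_big [leRHS]mulrDl /=; apply: lerD.
  rewrite ler_wpM2l ?powR_ge0 // sum_le ?mul0r // lexx andbT.
  by rewrite mulr_ge0 // ltW.
apply: le_trans (_ : _ <= \sum_(j < J) (2 ^+ j)^-1 * T) _; last first.
  by rewrite -big_distrl ler_wpM2r // sum_invX2_le2.
apply: ler_sum => j _; rewrite -big_distrr ler_wpM2l ?invr_ge0 ?exprn_ge0 // sum_le //.
- by rewrite divr_ge0 ?mulr_ge0 ?exprn_ge0 // ltW.
- rewrite divr_ge0 ?exprn_ge0 ?(ltW t0) //= ler_pdivrMr ?exprn_gt0 //.
  have : 1 <= 2 ^+ j :> R by rewrite exprn_ege1 // ler1n.
  by nra.
- by rewrite mulrA divfK ?gt_eqF // mulfK // expf_neq0 // pnatr_eq0.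
Qed.

End RankinSum.

Lemma mean_trunc_euler_prod_le {R : realType} {A : Type} (X : seq A) (g : A -> R)
    (ind : nat -> A -> R) (eta h : nat -> R) (M E Y Q : R) (s : seq nat) (n : nat) :
  0 <= M -> 0 <= E -> 0 <= Q <= Y -> uniq s -> all prime s -> prob_on_primes eta ->
  {in s, forall p, 0 <= h p} -> equidistributed X g ind eta M E Y [::] ->
  \sum_(x <- X) g x * trunc_euler_prod s Q (fun p => h p * ind p x) <=
  M * \prod_(p <- s) (1 + h p * eta p)
  + E * Q ^+ n * \prod_(p <- s) (1 + h p / p%:R ^+ n).
Proof.
move=> M0 E0 /andP[Q0 QY] us ps eta_prob h0 equiX.
apply: le_trans (_ : _ <= \sum_(D <- subseqs s | modulus D <= Q)
    \prod_(p <- D) h p * (M * \prod_(p <- D) eta p + E)) _.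
  under eq_bigr do rewrite big_distrr.
  rewrite exchange_big /=; apply: ler_sum_seq => D sD DQ.
  have sub := mem_subseqs sD.
  have pD : all prime D by apply/allP => p /(mem_subseq sub)/(allP ps).
  have := equiX D (subseq_uniq sub us) pD (fun p _ => isT) (le_trans DQ QY).
  rewrite ler_norml lerBlDl => /andP[_ /(ler_wpM2l (prod_subseqs_ge0 h0 sD))].
  apply: le_trans; rewrite big_distrr /=; apply: ler_sum => x _.
  by rewrite big_split mulrCA.
rewrite (eq_bigr (fun D => M * \prod_(p <- D) (h p * eta p) + E * \prod_(p <- D) h p));
  last by move=> D _; rewrite big_split /=; ring.
rewrite big_split -!big_distrr /= -mulrA; apply: lerD; apply: ler_wpM2l => //.
  apply: trunc_euler_prod_le => p sp; rewrite mulr_ge0 ?h0 //.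
  by have /andP[] := eta_prob p (allP ps p sp).
exact: trunc_euler_prod_leX.
Qed.

Section UpperModel.
Context {R : realType}.
Implicit Types (alpha c M E K N t k x : R) (eta : nat -> R).

Lemma prod_rankin_weight_le alpha c M E K N t k eta : 1 <= alpha -> 0 <= c -> 2 <= N ->
  prob_on_primes eta -> mertens c M E eta -> 0 <= t <= ln N -> 0 <= k -> k * t <= K ->
  \prod_(p <- primes_upto (expR t)) (1 + rankin_weight alpha k p * eta p) <=
  expR ((alpha - 1) * (M + `|E| / ln 2) + alpha * (2 * dyadic_bound c E * K * expR K))
    * ln N `^ ((alpha - 1) * c).
Proof.
move=> alpha1 c0 N2 eta_prob etaM /andP[t0 tN] k0 ktK.
have alpha_sub1_ge0 : 0 <= alpha - 1 by rewrite subr_ge0.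
have alpha_ge0 := le_trans ler01 alpha1.
apply: le_trans (prod1D_le_expR_sum _) _.
  move=> p pt _; have eta0 := prob_primes_upto_ge0 eta_prob pt.
  move: pt; rewrite mem_primes_upto => /andP[pp _].
  by rewrite addr_ge0 // mulr_ge0 // rankin_weight_ge0.
rewrite (powR_gt0E _ (ln_ge2_gt0 N2)) -expRD ler_expR.
rewrite (eq_bigr (fun p => (alpha - 1) * eta p + alpha * (eta p * (p%:R `^ k - 1))));
  last by move=> p _; rewrite /rankin_weight; ring.
rewrite big_split /= -!big_distrr /=.
have tN' : expR t <= N by rewrite -[leRHS]lnK ?ler_expR // posrE; lra.
have := lerD (ler_wpM2l alpha_sub1_ge0 (mertens_sum_le eta_prob etaM N2 tN'))
  (ler_wpM2l alpha_ge0 (mertens_sum_powR_sub1_le c0 eta_prob etaM t0 k0 ktK)).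
by congr (_ <= _); ring.
Qed.

Lemma prod_rankin_weight_inv_sqr_le alpha K t k : 1 <= alpha -> 0 <= k -> k * t <= K ->
  \prod_(p <- primes_upto (expR t)) (1 + rankin_weight alpha k p / p%:R ^+ 2)
    <= expR (2 * (alpha * expR K)).
Proof.
move=> alpha1 k0 ktK; have alpha_ge0 := le_trans ler01 alpha1.
apply: le_trans (prod_primes_inv_sqr_le (expR t) _); last by rewrite mulr_ge0 ?expR_ge0.
apply: ler_prod_seq => p; rewrite mem_primes_upto => /andP[pp pt] _.
have weight0 := rankin_weight_ge0 alpha1 k0 pp.
rewrite addr_ge0 ?divr_ge0 ?exprn_ge0 //= lerD2l ler_wpM2r ?invr_ge0 ?exprn_ge0 //.
apply: le_trans (_ : _ <= alpha * p%:R `^ k) _; first by rewrite gerBl.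
by rewrite ler_wpM2l // (powR_prime_le_expR pp k0 ktK pt).
Qed.

Definition rankin_mean_bound alpha c M E K0 K : R :=
  expR ((alpha - 1) * (M + `|E| / ln 2) + alpha * (2 * dyadic_bound c E * K * expR K))
  + K0 * expR (2 * (alpha * expR K)) / ln 2 `^ ((alpha - 1) * c).

Lemma rankin_mean_bound_gt0 alpha c M E K0 K : 0 <= K0 ->
  0 < rankin_mean_bound alpha c M E K0 K.
Proof.
by move=> K00; rewrite ltr_pwDl ?expR_gt0 // divr_ge0 ?powR_ge0 // mulr_ge0 ?expR_ge0.
Qed.

Lemma mean_rankin_sum_le (A : Type) (X : seq A) (ind : nat -> A -> R)
    alpha c M E K0 K N Q Y err k t eta :
  1 <= alpha -> 0 <= c -> 2 <= N -> prob_on_primes eta -> mertens c M E eta ->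
  equidistributed X (fun=> 1) ind eta (size X)%:R ((size X)%:R * err) Y [::] ->
  0 <= err -> 0 <= Q <= Y -> err * Q ^+ 2 <= K0 ->
  0 <= k -> 0 <= t <= ln N -> k * t <= K ->
  \sum_(x <- X) rankin_sum alpha k Q (expR t) (ind ^~ x) <=
  (size X)%:R * (rankin_mean_bound alpha c M E K0 K * ln N `^ ((alpha - 1) * c)).
Proof.
move=> alpha1 c0 N2 eta_prob etaM equiX err0 QY errQ k0 tN ktK.
have expo_ge0 : 0 <= (alpha - 1) * c by rewrite mulr_ge0 // subr_ge0.
have weight0 : {in primes_upto (expR t), forall p, 0 <= rankin_weight alpha k p}.
  by move=> p; rewrite mem_primes_upto => /andP[pp _]; apply: rankin_weight_ge0.
have inv_sqr_prod_ge0 :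
    0 <= \prod_(p <- primes_upto (expR t)) (1 + rankin_weight alpha k p / p%:R ^+ 2).
  by apply: prodr_ge0_seq => p /weight0 w0 _; rewrite addr_ge0 // divr_ge0 // exprn_ge0.
have size0 : 0 <= (size X)%:R :> R by [].
under eq_bigr do rewrite -[rankin_sum _ _ _ _ _]mul1r.
apply: le_trans (mean_trunc_euler_prod_le 2 size0 (mulr_ge0 size0 err0) QY
  (primes_upto_uniq _) (all_prime_primes_upto _) eta_prob weight0 equiX) _.
rewrite -[_ * err * _]mulrA -[_ * (err * _) * _]mulrA -mulrDr ler_wpM2l // mulrDl.
apply: lerD.
  exact: prod_rankin_weight_le tN k0 ktK.
rewrite -[leRHS]mulrA -[leRHS]mulrA; apply: ler_pM.
- by case/andP: QY => Q0 _; rewrite mulr_ge0 ?exprn_ge0.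
- exact: inv_sqr_prod_ge0.
- exact: errQ.
rewrite -[leLHS]mulr1; apply: ler_pM => //; first exact: prod_rankin_weight_inv_sqr_le.
rewrite ler_pdivlMl ?powR_gt0 ?ln2_gt0 // mulr1.
by rewrite ge0_ler_powR ?nnegrE ?(ltW ln2_gt0) ?(ltW (ln_ge2_gt0 N2)) ?ln2_le_ln.
Qed.

End UpperModel.

Section UpperBound.
Context {R : realType} (alpha xi c M E K0 C : R).
Hypotheses (alpha_gt1 : 1 < alpha) (xi_gt0 : 0 < xi) (c_ge0 : 0 <= c) (K0_ge0 : 0 <= K0)
  (C_ge0 : 0 <= C).

Lemma euler_prod_le_expn_size (A : eqType) (f : nat -> A -> int) (z : R) x :
  sign_valued f ->
  euler_prod alpha f z x <= alpha ^+ size [seq p <- primes_upto z | f p x == 1].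
Proof.
move=> f_sign; rewrite size_filter -prodr_const_seq [leRHS]big_mkcond /=.
apply: ler_prod_seq => p; rewrite mem_primes_upto => /andP[pp _] _.
rewrite exprz_ge0 ?(le_trans ler01 (ltW alpha_gt1)) //=.
apply: le_trans (exprz_sign_le x alpha_gt1 f_sign pp) _; rewrite /sign_ind.
by case: eqP => _; rewrite ?mulr1 ?mulr0 ?addr0 // subrKC.
Qed.

Lemma euler_prod_le_rankin_majorant (A : eqType) (f : nat -> A -> int) (z r t : R) J x :
  sign_valued f -> 0 <= r -> 0 < t -> t / 2 ^+ J < ln 2 ->
  modulus [seq p <- primes_upto z | f p x == 1] <= expR (r * t) ->
  euler_prod alpha f z x <= rankin_majorant alpha r t J (sign_ind f 1 ^~ x).
Proof.
move=> f_sign r0 t0 tJ modulus_le; apply: le_trans (euler_prod_le_expn_size z x f_sign) _.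
apply: expn_size_le_rankin_majorant => //; first exact: ltW.
- by move=> p; rewrite mem_filter /sign_ind => /andP[->].
- by rewrite sorted_filter ?primes_upto_sorted //; apply: ltn_trans.
- exact: all_prime_filter_primes_upto.
Qed.

Lemma sum_euler_prod_upper_bound :
  exists2 B : R, 0 < B & forall (A : eqType) (X : seq A) (f : nat -> A -> int)
    (eta : nat -> R) (N z : R),
  2 <= N -> prob_on_primes eta -> mertens c M E eta -> sign_valued f ->
  equidistributed X (fun=> 1) (sign_ind f 1) eta (size X)%:R
    ((size X)%:R * (K0 * N `^ (- xi))) (N `^ (xi / 2)) [::] ->
  {in X, forall x, modulus [seq p <- primes_upto z | f p x == 1] <= N `^ C} ->
  \sum_(x <- X) euler_prod alpha f z x <= B * (size X)%:R * ln N `^ ((alpha - 1) * c).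
Proof.
set d : R := Num.min (1 / 2) (xi / 8).
have d_gt0 : 0 < d by rewrite lt_min !divr_gt0.
have d_half : d <= 1 / 2 by rewrite ge_min lexx.
have d_xi : d <= xi / 8 by rewrite ge_min lexx orbT.
have r_ge0 : 0 <= C / d by rewrite divr_ge0 // ltW.
have alpha_ge1 := ltW alpha_gt1.
set G := rankin_mean_bound alpha c M E K0 (rankin_const alpha (C / d)).
have G_gt0 : 0 < G by apply: rankin_mean_bound_gt0.
exists ((alpha `^ (C / d) + 2) * G).
  by rewrite mulr_gt0 // addr_gt0 ?powR_gt0 // (lt_trans ltr01).
move=> A X f eta N z N2 eta_prob etaM f_sign equiX modulus_le.
have N_gt0 : 0 < N by lra.
have lnN_gt0 := ln_ge2_gt0 N2; have t_gt0 : 0 < d * ln N by rewrite mulr_gt0.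
have [J ltJ] := exists_pow2_gt (d * ln N / ln 2).
have {}ltJ : d * ln N / 2 ^+ J < ln 2.
  by rewrite ltr_pdivrMr ?exprn_gt0 // [ltRHS]mulrC -ltr_pdivrMr ?ln2_gt0.
apply: le_trans (_ : _ <= \sum_(x <- X)
    rankin_majorant alpha (C / d) (d * ln N) J (sign_ind f 1 ^~ x)) _.
  apply: ler_sum_seq => x xX _; apply: euler_prod_le_rankin_majorant => //.
  rewrite mulrA divfK ?gt_eqF // -powR_gt0E //; exact: modulus_le.
rewrite -!mulrA [G * _]mulrCA; apply: sum_rankin_majorant_le => //.
  by rewrite !mulr_ge0 ?powR_ge0 // ltW.
move=> k t k0 /andP[t0 t_le] kt_le.
apply: mean_rankin_sum_le (equiX) _ _ _ k0 _ kt_le => //.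
- by rewrite mulr_ge0 ?powR_ge0.
- by rewrite expR_ge0 powR_gt0E // ler_expR mulrA ler_wpM2r ?(ltW lnN_gt0) //; lra.
- rewrite -mulrA ler_piMr // powR_gt0E // -expRM_natl -expRD -[leRHS]expR0 ler_expR.
  by nra.
- by rewrite t0 (le_trans t_le) // mulrA ler_piMl ?(ltW lnN_gt0) //; lra.
Qed.

End UpperBound.

Section EulerProductLowerBounds.
Context {R : realType}.
Implicit Types (a b c e k m t v z theta K M E : R) (eta F G : nat -> R) (p : nat).

Lemma prod_primes_ge_expR z (B : R) F G : 0 <= B ->
  (forall p, prime p -> expR (F p - B / p%:R ^+ 2) <= G p) ->
  expR (\sum_(p <- primes_upto z) F p - 2 * B) <= \prod_(p <- primes_upto z) G p.
Proof.
move=> B0 FG.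
apply: le_trans (_ : _ <= \prod_(p <- primes_upto z) expR (F p - B / p%:R ^+ 2)) _.
  rewrite -expR_sum ler_expR sumrB -big_distrr /= lerD2l lerN2 mulrC.
  by rewrite ler_wpM2r // sum_primes_inv_sqr_le2.
by apply: ler_prod_seq => p; rewrite mem_primes_upto => /andP[/FG ? _] _; rewrite expR_ge0.
Qed.

Lemma scaled_density_sqr_le a K eta p : 0 <= a -> 0 <= eta p -> eta p <= K / p%:R ->
  (a * eta p) ^+ 2 <= (a * K) ^+ 2 / p%:R ^+ 2.
Proof.
move=> a0 eta0 etaK; have K0 := le_trans eta0 etaK.
by rewrite -expr_div_n -[a * K / _]mulrA lerXn2r ?nnegrE ?(mulr_ge0 a0) // ler_wpM2l.
Qed.

Lemma prod_primes_1add_ge a K z eta : 0 <= a -> prob_on_primes eta ->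
  (forall p, prime p -> eta p <= K / p%:R) ->
  expR (a * \sum_(p <- primes_upto z) eta p - 2 * (a * K) ^+ 2)
    <= \prod_(p <- primes_upto z) (1 + a * eta p).
Proof.
move=> a0 eta_prob etaK; rewrite big_distrr.
apply: prod_primes_ge_expR; first exact: sqr_ge0.
move=> p pp; have /andP[eta0 _] := eta_prob _ pp.
have t0 : 0 <= a * eta p by rewrite mulr_ge0.
have u_gt0 : 0 < 1 + a * eta p by rewrite ltr_wpDr.
apply: le_trans (expR_1subV_le u_gt0); rewrite ler_expR.
have -> : 1 - (1 + a * eta p)^-1 = a * eta p - (a * eta p) ^+ 2 / (1 + a * eta p).
  by field; rewrite gt_eqF.
rewrite lerD2l lerN2; apply: le_trans (scaled_density_sqr_le a0 eta0 (etaK _ pp)).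
by rewrite ler_pdivrMr // ler_peMr ?sqr_ge0 // lerDl.
Qed.

Lemma prod_primes_1sub_ge theta K z eta : 0 <= theta < 1 -> prob_on_primes eta ->
  (forall p, prime p -> eta p <= K / p%:R) ->
  expR (- (theta * \sum_(p <- primes_upto z) eta p) - 2 * ((theta * K) ^+ 2 / (1 - theta)))
    <= \prod_(p <- primes_upto z) (1 - theta * eta p).
Proof.
move=> /andP[theta0 theta1] eta_prob etaK; rewrite big_distrr -sumrN.
have denom_gt0 : 0 < 1 - theta by rewrite subr_gt0.
apply: prod_primes_ge_expR; first by rewrite divr_ge0 ?sqr_ge0 // ltW.
move=> p pp; have /andP[eta0 eta1] := eta_prob _ pp.
have denom_le : 1 - theta <= 1 - theta * eta p by rewrite lerD2l lerN2 ler_piMr.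
have u_gt0 := lt_le_trans denom_gt0 denom_le.
apply: le_trans (expR_1subV_le u_gt0); rewrite ler_expR.
have -> : 1 - (1 - theta * eta p)^-1 =
    - (theta * eta p) - (theta * eta p) ^+ 2 / (1 - theta * eta p).
  by field; rewrite gt_eqF.
rewrite lerD2l lerN2 [leRHS]mulrAC.
apply: ler_pM; rewrite ?sqr_ge0 ?invr_ge0 ?(ltW u_gt0) //.
  exact: scaled_density_sqr_le (etaK _ pp).
by rewrite lef_pV2 ?posrE.
Qed.

Lemma prod_primes_shift_le a c M E eta t k K : 0 <= a -> 0 <= c -> prob_on_primes eta ->
  mertens c M E eta -> 0 <= t -> 0 <= k -> k * t <= K ->
  \prod_(p <- primes_upto (expR t)) (1 + a * eta p * p%:R `^ k) <=
  \prod_(p <- primes_upto (expR t)) (1 + a * eta p)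
    * expR (a * (2 * dyadic_bound c E * K * expR K)).
Proof.
move=> a0 c0 eta_prob etaM t0 k0 ktK.
have in_primes p : p \in primes_upto (expR t) ->
    0 <= a * eta p /\ 0 <= a * (eta p * (p%:R `^ k - 1)).
  move=> pt; have eta0 := prob_primes_upto_ge0 eta_prob pt.
  move: pt; rewrite mem_primes_upto => /andP[pp _].
  by rewrite !mulr_ge0 // subr_ge0 powR_prime_ge1.
apply: le_trans (_ : _ <= \prod_(p <- primes_upto (expR t)) (1 + a * eta p)
    * \prod_(p <- primes_upto (expR t)) (1 + a * (eta p * (p%:R `^ k - 1)))) _.
  rewrite -big_split /=; apply: ler_prod_seq => p /in_primes[x0 y0] _.
  rewrite addr_ge0 ?(mulr_ge0 x0) ?powR_ge0 //=.
  have -> : 1 + a * eta p * p%:R `^ k =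
    1 + a * eta p + a * (eta p * (p%:R `^ k - 1)) by ring.
  by rewrite [leRHS]mulrDr mulr1 lerD2l ler_peMl // lerDl.
apply: ler_wpM2l; first by apply: prodr_ge0_seq => p /in_primes[x0 _] _; rewrite addr_ge0.
apply: le_trans (prod1D_le_expR_sum _) _.
  by move=> p /in_primes[_ y0] _; rewrite addr_ge0.
rewrite ler_expR -big_distrr /= ler_wpM2l //.
by rewrite (mertens_sum_powR_sub1_le c0 eta_prob etaM t0 k0 ktK).
Qed.

Definition rankin_half_exponent a c E : R := a * (2 * dyadic_bound c E * expR 1) + 1.

Lemma rankin_half_exponent_gt0 a c E : 0 <= a -> 0 <= c -> 0 < rankin_half_exponent a c E.
Proof.
by move=> a0 c0; rewrite ltr_wpDl // !mulr_ge0 ?expR_ge0 ?dyadic_bound_ge0.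
Qed.

Lemma trunc_euler_prod_ge_half a c M E eta t v : 0 <= a -> 0 <= c -> prob_on_primes eta ->
  mertens c M E eta -> 0 < t ->
  rankin_half_exponent a c E * t <= v ->
  1 / 2 * \prod_(p <- primes_upto (expR t)) (1 + a * eta p) <=
  trunc_euler_prod (primes_upto (expR t)) (expR v) (fun p => a * eta p).
Proof.
move=> a0 c0 eta_prob etaM t0; rewrite /rankin_half_exponent.
set T := a * _; set P := \prod_(p <- _) _ => tv.
have weight0 : {in primes_upto (expR t), forall p, 0 <= a * eta p}.
  by move=> p pt; rewrite mulr_ge0 // (prob_primes_upto_ge0 eta_prob pt).
have P0 : 0 <= P by apply: prodr_ge0_seq => p /weight0 w0 _; rewrite addr_ge0.
have k0 : 0 <= t^-1 by rewrite invr_ge0 ltW.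
have kt : t^-1 * t <= 1 by rewrite mulVf // gt_eqF.
have := rankin_tail weight0 k0 (expR_gt0 v).
have := prod_primes_shift_le a0 c0 eta_prob etaM (ltW t0) k0 kt.
rewrite mulr1 -/P -/T => /(ler_wpM2l (powR_ge0 (expR v) (- t^-1))) shift_le tail_le.
suff : expR v `^ (- t^-1) * (P * expR T) <= 1 / 2 * P by lra.
rewrite mulrCA [leRHS]mulrC ler_wpM2l // -expRM mulrN -expRD.
apply: le_trans (_ : expR (- 1) <= _).
  have : T + 1 <= v / t by rewrite ler_pdivlMr.
  by rewrite ler_expR; lra.
rewrite expRN div1r lef_pV2 ?posrE ?expR_gt0 //; exact: expR_ge1Dx.
Qed.

Lemma expR_decay_le_powR b m e K : 0 < b -> 0 < m ->
  exists x0, forall x, x0 <= x -> K * expR (- (b * x)) <= m * x `^ e.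
Proof.
move=> b0 m0; set n := `|e| + 1; have n0 : 0 < n by rewrite ltr_wpDl.
set s := b / (2 * n); have s0 : 0 < s by rewrite divr_gt0 // mulr_gt0.
exists (Num.max 1 (2 * (K / m - n * ln s) / b)) => x.
rewrite ge_max ler_pdivrMr // => /andP[x1 x_large].
have x0 : 0 < x := lt_le_trans ltr01 x1.
have ln_x_le : ln x <= x * s - ln s.
  have := ltW (ln_sublinear (mulr_gt0 x0 s0)).
  by rewrite lnM ?posrE // -lerBrDr.
have powR_ge : - (n * (x * s - ln s)) <= e * ln x.
  apply: le_trans (_ : - (n * ln x) <= _); first by rewrite lerN2 ler_wpM2l // ltW.
  rewrite -mulNr ler_wpM2r ?ln_ge0 // /n opprD.
  by have := ler_norm (- e); rewrite normrN; lra.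
have half_exponent : n * (x * s) = b * x / 2 by rewrite /s; field; rewrite gt_eqF.
have exponent_ge : K / m <= b * x + e * ln x.
  by move: powR_ge; rewrite mulrBr half_exponent; lra.
rewrite powR_gt0E // expRN ler_pdivrMr ?expR_gt0 // -mulrA -expRD.
rewrite addrC mulrC -ler_pdivrMr //.
by apply: le_trans exponent_ge _; apply: le_trans (expR_ge1Dx _); rewrite lerDr.
Qed.

Lemma powR_segment_le e (x u y : R) : 0 < x -> x <= u <= y -> u `^ e <= x `^ e + y `^ e.
Proof.
move=> x0 /andP[xu uy]; have u0 := lt_le_trans x0 xu; have y0 := lt_le_trans u0 uy.
have [e0|e0] := leP 0 e.
  apply: le_trans (_ : y `^ e <= _); last by rewrite lerDr powR_ge0.
  by rewrite ge0_ler_powR ?nnegrE ?(ltW u0) ?(ltW y0).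
apply: le_trans (_ : x `^ e <= _); last by rewrite lerDl powR_ge0.
rewrite -[e]opprK [u `^ _]powRN [x `^ _]powRN lef_pV2 ?posrE ?powR_gt0 //.
by rewrite ge0_ler_powR ?nnegrE ?oppr_ge0 ?(ltW e0) ?(ltW x0) ?(ltW u0).
Qed.

End EulerProductLowerBounds.

Section SignSieve.
Context {R : realType} {A : eqType}.
Variables (X : seq A) (f : nat -> A -> int) (etap etam : nat -> R).
Variables (theta L t err Q Y : R) (k : nat).
Hypotheses (theta01 : 0 <= theta < 1) (t_ge0 : 0 <= t).
Hypotheses (err_ge0 : 0 <= err) (Q_ge0 : 0 <= Q).
Hypotheses (etap_prob : prob_on_primes etap) (etam_prob : prob_on_primes etam).
Hypotheses (k_depth : sieve_depth theta L k) (dyadic_mass : dyadic_mass_le L etam).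
Hypotheses (signX : sign_equidistributed X f etap etam err Y)
  (level_le : sieve_level k t * Q <= Y).

Lemma minus_sieve_ge D : D \in subseqs (primes_upto (expR t)) -> modulus D <= Q ->
  (size X)%:R * (\prod_(p <- D) etap p / 2 *
      \prod_(p <- primes_upto (expR t)) (1 - theta * etam p)
    - err * expR (2 * theta) * sieve_level k t ^+ 2) <=
  \sum_(x <- X) \prod_(p <- D) sign_ind f 1 p x *
    \prod_(p <- primes_upto (expR t)) (1 - theta * sign_ind f (-1) p x).
Proof.
move=> /mem_subseqs sD DQ.
have uD : uniq D := subseq_uniq sD (primes_upto_uniq _).
have pD : all prime D.
  by apply/allP => p /(mem_subseq sD); rewrite mem_primes_upto => /andP[].
have etaD0 : 0 <= \prod_(p <- D) etap p.
  by apply: prodr_ge0_seq => p /(allP pD)/etap_prob/andP[].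
have DY : sieve_level k t * modulus D <= Y.
  by apply: le_trans level_le; rewrite ler_wpM2l ?expR_ge0.
have prod_ind_ge0 x : 0 <= \prod_(p <- D) sign_ind f 1 p x :> R.
  by apply: prodr_ge0 => p _; apply: sign_ind_ge0.
have := brun_hooley_lower_bound (mulr_ge0 (ler0n R (size X)) etaD0)
  (mulr_ge0 (ler0n R (size X)) err_ge0) t_ge0 theta01 etam_prob k_depth dyadic_mass
  prod_ind_ge0 (sign_ind01 f (-1)) (minus_equidistributed signX uD pD DY).
have factor01 p : p \in primes_upto (expR t) -> 0 <= 1 - theta * etam p <= 1.
  rewrite mem_primes_upto => /andP[/etam_prob/(scaled_prob theta01)/andP[y0 y1] _].
  by rewrite subr_ge0 y1 gerBl.
move=> sieve_ge; apply: le_trans (le_trans _ sieve_ge) _.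
  rewrite mulrBr -!mulrA lerB // ler_wpM2l // ler_wpM2l // ler_wpM2l ?invr_ge0 //.
  rewrite (bigID (fun p => p \notin D)) /= ler_piMr //.
    by apply: prodr_ge0_seq => p /factor01/andP[].
  by apply: prodr_le1_seq => p /factor01.
apply: ler_sum => x _; rewrite prod_sign_ind.
case: allP => f_eq1; rewrite ?mul0r // !mul1r.
rewrite [leRHS](bigID (fun p => p \notin D)) /=.
rewrite [T in _ <= _ * T]big1 ?mulr1 // => p; rewrite negbK => /f_eq1/eqP fp.
by rewrite /sign_ind fp mulr0 subr0.
Qed.

Lemma sum_trunc_minus_sieve_ge (a : R) : 0 <= a ->
  (size X)%:R * (1 / 2 * trunc_euler_prod (primes_upto (expR t)) Q (fun p => a * etap p) *
      \prod_(p <- primes_upto (expR t)) (1 - theta * etam p)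
    - err * expR (2 * theta) * sieve_level k t ^+ 2 * (Q ^+ 2 * expR (2 * a))) <=
  \sum_(x <- X)
    trunc_euler_prod (primes_upto (expR t)) Q (fun p => a * sign_ind f 1 p x) *
    \prod_(p <- primes_upto (expR t)) (1 - theta * sign_ind f (-1) p x).
Proof.
move=> a0; set P := \prod_(p <- _) _; set e := err * _ * _.
have e_ge0 : 0 <= e by rewrite !mulr_ge0 ?expR_ge0.
have divisor_sum_le : trunc_euler_prod (primes_upto (expR t)) Q (fun=> a)
    <= Q ^+ 2 * expR (2 * a).
  apply: le_trans (trunc_euler_prod_leX 2 Q_ge0 (fun _ _ => a0)
    (all_prime_primes_upto _)) _.
  by rewrite ler_wpM2l ?exprn_ge0 // prod_primes_inv_sqr_le.
apply: le_trans (_ : _ <= \sum_(D <- subseqs (primes_upto (expR t)) | modulus D <= Q)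
    a ^+ size D * ((size X)%:R * (\prod_(p <- D) etap p / 2 * P - e))) _.
  have -> : \sum_(D <- subseqs (primes_upto (expR t)) | modulus D <= Q)
      a ^+ size D * ((size X)%:R * (\prod_(p <- D) etap p / 2 * P - e)) =
      (size X)%:R *
      (1 / 2 * trunc_euler_prod (primes_upto (expR t)) Q (fun p => a * etap p) * P
       - e * trunc_euler_prod (primes_upto (expR t)) Q (fun=> a)).
    rewrite !big_distrr big_distrl /= -sumrB big_distrr; apply: eq_bigr => D _.
    by rewrite big_split /= prodr_const_seq count_predT; ring.
  by rewrite ler_wpM2l // lerD2l lerN2 ler_wpM2l.
under [leRHS]eq_bigr do rewrite big_distrl.
rewrite exchange_big /=; apply: ler_sum_seq => D sD DQ.
rewrite (eq_bigr (fun x => a ^+ size D * (\prod_(p <- D) sign_ind f 1 p x *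
    \prod_(p <- primes_upto (expR t)) (1 - theta * sign_ind f (-1) p x)))); last first.
  by move=> x _; rewrite big_split /= prodr_const_seq count_predT mulrA.
by rewrite -big_distrr ler_wpM2l ?exprn_ge0 // minus_sieve_ge.
Qed.

End SignSieve.

Section LowerBound.
Context {R : realType}.

Definition model_lower_const (a theta Mp Mm Ep Em Kp Km : R) : R :=
  expR (a * (Mp - `|Ep| / ln 2) - 2 * (a * Kp) ^+ 2
    - theta * (Mm + `|Em| / ln 2) - 2 * ((theta * Km) ^+ 2 / (1 - theta))).

Definition sieve_density (c M E K : R) (eta : nat -> R) : Prop :=
  [/\ prob_on_primes eta, mertens c M E eta & forall p, prime p -> eta p <= K / p%:R].

Lemma prod_model_ge (a theta cp cm Mp Mm Ep Em Kp Km z : R) (etap etam : nat -> R) :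
  0 <= a -> 0 <= theta < 1 -> 2 <= z ->
  sieve_density cp Mp Ep Kp etap -> sieve_density cm Mm Em Km etam ->
  model_lower_const a theta Mp Mm Ep Em Kp Km * ln z `^ (a * cp - theta * cm) <=
  \prod_(p <- primes_upto z) (1 + a * etap p) *
  \prod_(p <- primes_upto z) (1 - theta * etam p).
Proof.
move=> a0 theta01 z2 [etap_prob etapM etapK] [etam_prob etamM etamK].
have [theta0 _] := andP theta01.
apply: le_trans (ler_pM (expR_ge0 _) (expR_ge0 _)
  (prod_primes_1add_ge z a0 etap_prob etapK)
  (prod_primes_1sub_ge z theta01 etam_prob etamK)).
rewrite (powR_gt0E _ (ln_ge2_gt0 z2)) -!expRD ler_expR.
have := ler_wpM2l a0 (mertens_sum_ge etapM z2).
by have := ler_wpM2l theta0 (mertens_sum_le etam_prob etamM z2 (lexx _)); lra.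
Qed.

Variables (alpha xi cp cm Mp Mm Ep Em K0 Kp Km C : R).
Hypotheses (alpha_gt1 : 1 < alpha) (xi_gt0 : 0 < xi) (cp_ge0 : 0 <= cp) (cm_ge0 : 0 <= cm)
  (K0_ge0 : 0 <= K0) (C_gt0 : 0 < C).

Local Notation a := (alpha - 1).
Local Notation theta := (1 - alpha^-1).
Local Notation expo := ((alpha - 1) * cp - (1 - alpha^-1) * cm).

Let alpha_gt0 : 0 < alpha. Proof. exact: lt_trans alpha_gt1. Qed.
Let a_ge0 : 0 <= a. Proof. by rewrite subr_ge0 ltW. Qed.
Let theta01 : 0 <= theta < 1.
Proof. by rewrite subr_ge0 gtrBl invr_gt0 alpha_gt0 invf_le1 // ltW. Qed.

Lemma euler_prod_ge_trunc (A : eqType) (f : nat -> A -> int) (t u Q : R) x :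
  sign_valued f -> 0 < t -> t <= u ->
  modulus [seq p <- primes_upto (expR u) | f p x == -1] <= expR u ->
  alpha `^ (- (u / t)) *
    (trunc_euler_prod (primes_upto (expR t)) Q (fun p => a * sign_ind f 1 p x) *
     \prod_(p <- primes_upto (expR t)) (1 - theta * sign_ind f (-1) p x))
  <= euler_prod alpha f (expR u) x.
Proof.
move=> f_sign t_gt0 tu modulus_le; have tu' : expR t <= expR u by rewrite ler_expR.
have plus_ge0 p : 0 <= a * sign_ind f 1 p x by rewrite mulr_ge0 ?sign_ind_ge0.
have minus_ge0 p : 0 <= 1 - theta * sign_ind f (-1) p x.
  by rewrite subr_ge0; have /andP[] := scaled_prob theta01 (sign_ind01 f (-1) p x).
rewrite /euler_prod (primes_upto_cat tu') big_cat mulrC.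
apply: ler_pM; rewrite ?powR_ge0 //.
- by rewrite mulr_ge0 ?prodr_ge0 // trunc_euler_prod_ge0.
- apply: le_trans (_ : _ <= \prod_(p <- primes_upto (expR t)) (1 + a * sign_ind f 1 p x) *
      \prod_(p <- primes_upto (expR t)) (1 - theta * sign_ind f (-1) p x)) _.
    by rewrite ler_wpM2r ?prodr_ge0 // trunc_euler_prod_le.
  rewrite -big_split; apply: ler_prod_seq => p; rewrite mem_primes_upto => /andP[pp _] _.
  by rewrite exprz_sign // lexx andbT mulr_ge0 // addr_ge0.
apply: prod_exprz_sign_ge => //; first exact: all_prime_primes_between.
  by apply/allP => p; rewrite mem_primes_between => /and3P[].
apply: le_trans modulus_le; apply: modulus_subseq.
  exact: all_prime_filter_primes_upto.
by rewrite (primes_upto_cat tu') filter_cat suffix_subseq.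
Qed.

Lemma sieve_error_le (N t : R) (k : nat) :
  2 <= N -> t * (2 * k + 6)%:R <= xi / 8 * ln N ->
  K0 * N `^ (- xi) * expR (2 * theta) * sieve_level k t ^+ 2 *
    (expR (xi / 8 * ln N) ^+ 2 * expR (2 * a)) <=
  K0 * expR (2 * theta + 2 * a) * expR (- (xi / 2 * ln N)).
Proof.
move=> N2 t_le; have N_gt0 : 0 < N by lra.
have -> : K0 * N `^ (- xi) * expR (2 * theta) * sieve_level k t ^+ 2 *
    (expR (xi / 8 * ln N) ^+ 2 * expR (2 * a)) =
    K0 * expR (2 * theta + 2 * a) *
    (N `^ (- xi) * sieve_level k t ^+ 2 * expR (xi / 8 * ln N) ^+ 2).
  by rewrite expRD; ring.
apply: ler_wpM2l; first by rewrite mulr_ge0 ?expR_ge0.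
by rewrite powR_gt0E // -!expRM_natl -!expRD ler_expR; lra.
Qed.

Lemma sum_euler_prod_ge_model (A : eqType) (X : seq A) (f : nat -> A -> int)
    (etap etam : nat -> R) (N t : R) (k : nat) :
  2 <= N -> 0 < t -> t <= C * ln N -> 2 <= expR t ->
  t * (2 * k + 6)%:R <= xi / 8 * ln N ->
  rankin_half_exponent a cp Ep * t <= xi / 8 * ln N ->
  sieve_depth theta (dyadic_bound cm Em) k ->
  sieve_density cp Mp Ep Kp etap -> sieve_density cm Mm Em Km etam -> sign_valued f ->
  sign_equidistributed X f etap etam (K0 * N `^ (- xi)) (N `^ (xi / 2)) ->
  {in X, forall x, modulus [seq p <- primes_upto (N `^ C) | f p x == -1] <= N `^ C} ->
  (size X)%:R * alpha `^ (- (C * ln N / t)) *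
    (1 / 4 * (model_lower_const a theta Mp Mm Ep Em Kp Km * t `^ expo)
     - K0 * expR (2 * theta + 2 * a) * expR (- (xi / 2 * ln N)))
  <= \sum_(x <- X) euler_prod alpha f (N `^ C) x.
Proof.
move=> N2 t_gt0 t_le z_ge2 level_le trunc_le k_depth densp densm f_sign signX modulus_le.
have [[etap_prob etapM _] [etam_prob etamM _]] := (densp, densm).
have N_gt0 : 0 < N by lra.
have xi_lnN_gt0 : 0 < xi * ln N by rewrite mulr_gt0 // ln_ge2_gt0.
have levelQ_le : sieve_level k t * expR (xi / 8 * ln N) <= N `^ (xi / 2).
  by rewrite powR_gt0E // -expRD ler_expR; lra.
have err_ge0 : 0 <= K0 * N `^ (- xi) by rewrite mulr_ge0 ?powR_ge0.
have NC : N `^ C = expR (C * ln N) by rewrite powR_gt0E.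
rewrite NC in modulus_le *.
apply: le_trans (ler_sum_seq (fun x xX _ =>
  euler_prod_ge_trunc (expR (xi / 8 * ln N)) f_sign t_gt0 t_le (modulus_le x xX))).
rewrite -big_distrr /= mulrAC mulrC ler_wpM2l ?powR_ge0 //.
apply: le_trans (sum_trunc_minus_sieve_ge theta01 (ltW t_gt0) err_ge0 (expR_ge0 _)
  etap_prob etam_prob k_depth (mertens_dyadic_mass cm_ge0 etam_prob etamM)
  signX levelQ_le a_ge0).
apply: ler_wpM2l => //; apply: lerB; last exact: sieve_error_le.
have := prod_model_ge a_ge0 theta01 z_ge2 densp densm; rewrite expRK => model_ge.
have := trunc_euler_prod_ge_half a_ge0 cp_ge0 etap_prob etapM t_gt0 trunc_le.
have minus_ge0 : 0 <= \prod_(p <- primes_upto (expR t)) (1 - theta * etam p).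
  apply: prod_1sub_ge0 => p; rewrite mem_primes_upto => /andP[pp _].
  exact: scaled_prob (etam_prob p pp).
move/(ler_wpM2r minus_ge0); lra.
Qed.

Lemma sum_euler_prod_lower_bound_large :
  exists B x0 : R, 0 < B /\
  forall (A : eqType) (X : seq A) (f : nat -> A -> int) (etap etam : nat -> R) (N : R),
  2 <= N -> x0 <= ln N ->
  sieve_density cp Mp Ep Kp etap -> sieve_density cm Mm Em Km etam -> sign_valued f ->
  sign_equidistributed X f etap etam (K0 * N `^ (- xi)) (N `^ (xi / 2)) ->
  {in X, forall x, modulus [seq p <- primes_upto (N `^ C) | f p x == -1] <= N `^ C} ->
  B * (size X)%:R * ln N `^ expo <= \sum_(x <- X) euler_prod alpha f (N `^ C) x.
Proof.
have [k k_depth] := exists_sieve_depth theta (dyadic_bound cm Em).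
set T := rankin_half_exponent a cp Ep.
have T_gt0 : 0 < T by apply: rankin_half_exponent_gt0.
have level_gt0 : 0 < (2 * k + 6)%:R :> R by rewrite ltr0n addn_gt0 orbT.
set eps := Num.min C (Num.min (xi / 8 / T) (xi / 8 / (2 * k + 6)%:R)).
have eps_gt0 : 0 < eps by rewrite !lt_min C_gt0 !divr_gt0.
have eps_le_C : eps <= C by rewrite ge_min lexx.
have eps_trunc : T * eps <= xi / 8 by rewrite mulrC -ler_pdivlMr // !ge_min lexx !orbT.
have eps_level : eps * (2 * k + 6)%:R <= xi / 8.
  by rewrite -ler_pdivlMr // !ge_min lexx !orbT.
set m := model_lower_const a theta Mp Mm Ep Em Kp Km * eps `^ expo.
have m_gt0 : 0 < m by rewrite mulr_gt0 ?expR_gt0 ?powR_gt0.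
have [x0 error_le] := expR_decay_le_powR expo (K0 * expR (2 * theta + 2 * a))
  (divr_gt0 xi_gt0 (ltr0n R 2)) (divr_gt0 m_gt0 (ltr0n R 8)).
exists (alpha `^ (- (C / eps)) * (m / 8)), (Num.max x0 (ln 2 / eps)); split.
  by rewrite mulr_gt0 ?powR_gt0 ?divr_gt0.
move=> A X f etap etam N N2; rewrite ge_max => /andP[/error_le{}error_le].
rewrite ler_pdivrMr // mulrC => ln_large densp densm f_sign signX modulus_le.
have lnN_gt0 := ln_ge2_gt0 N2.
apply: le_trans (sum_euler_prod_ge_model (t := eps * ln N) N2 _ _ _ _ _ k_depth
  densp densm f_sign signX modulus_le).
- have -> : C * ln N / (eps * ln N) = C / eps by field; rewrite !gt_eqF.
  rewrite powRM ?(ltW eps_gt0) ?(ltW lnN_gt0) // [_ * (eps `^ _ * _)]mulrA -/m.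
  have -> : alpha `^ (- (C / eps)) * (m / 8) * (size X)%:R * ln N `^ expo =
    (size X)%:R * alpha `^ (- (C / eps)) * (m / 8 * ln N `^ expo) by ring.
  by rewrite ler_wpM2l ?mulr_ge0 ?powR_ge0 //; lra.
- by rewrite mulr_gt0.
- by rewrite ler_wpM2r // ltW.
- by rewrite -[leLHS]lnK ?posrE // ler_expR.
- by rewrite mulrAC ler_wpM2r // ltW.
- by rewrite -/T [T * _]mulrA ler_wpM2r // ltW.
Qed.

(* For bounded [N] each Euler product has boundedly many factors below [1]. *)
Lemma sum_euler_prod_lower_bound_small (b x0 : R) :
  exists2 B : R, 0 < B & forall (A : eqType) (X : seq A) (f : nat -> A -> int) (N : R),
  2 <= N -> ln N <= x0 -> sign_valued f ->
  {in X, forall x, modulus [seq p <- primes_upto (N `^ C) | f p x == -1] <= N `^ C} ->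
  B * (size X)%:R * ln N `^ b <= \sum_(x <- X) euler_prod alpha f (N `^ C) x.
Proof.
set bound := ln 2 `^ b + x0 `^ b; set G := alpha `^ (- (C * x0 / (ln 2 / 2))).
have bound_gt0 : 0 < bound by rewrite ltr_wpDr ?powR_ge0 // powR_gt0 ?ln2_gt0.
exists (G / bound) => [|A X f N N2 lnN_le f_sign modulus_le].
  by rewrite divr_gt0 ?powR_gt0.
have half_ln2_gt0 : 0 < ln 2 / 2 :> R by rewrite divr_gt0 ?ln2_gt0.
apply: le_trans (_ : _ <= \sum_(x <- X) G) _; last first.
  apply: ler_sum_seq => x xX _.
  apply: le_trans (_ : _ <= alpha `^ (- (C * ln N / (ln 2 / 2)))) _.
    rewrite ler_powR ?(ltW alpha_gt1) // lerN2 ler_wpM2r ?invr_ge0 ?(ltW half_ln2_gt0) //.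
    by rewrite ler_wpM2l // ltW.
  apply: prod_exprz_sign_ge => //; first exact: all_prime_primes_upto.
    apply/allP => p; rewrite mem_primes_upto => /andP[/prime_gt1 p_gt1 _].
    apply: lt_le_trans (_ : 2 <= _); last by rewrite ler_nat.
    by rewrite -[ltRHS]lnK ?posrE // ltr_expR ltr_pdivrMr // ltr_pMr ?ln2_gt0 // ltr1n.
  by rewrite -powR_gt0E ?modulus_le //; lra.
rewrite sumr_const_seq count_predT -[leRHS]mulr_natr mulrAC ler_wpM2r //.
rewrite mulrAC ler_pdivrMr // ler_wpM2l ?powR_ge0 //.
by rewrite powR_segment_le ?ln2_gt0 // ln2_le_ln.
Qed.

Lemma sum_euler_prod_lower_bound :
  exists2 B : R, 0 < B &
  forall (A : eqType) (X : seq A) (f : nat -> A -> int) (etap etam : nat -> R) (N : R),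
  2 <= N ->
  sieve_density cp Mp Ep Kp etap -> sieve_density cm Mm Em Km etam -> sign_valued f ->
  sign_equidistributed X f etap etam (K0 * N `^ (- xi)) (N `^ (xi / 2)) ->
  {in X, forall x, modulus [seq p <- primes_upto (N `^ C) | f p x == -1] <= N `^ C} ->
  B * (size X)%:R * ln N `^ expo <= \sum_(x <- X) euler_prod alpha f (N `^ C) x.
Proof.
have [Blarge [x0 [Blarge_gt0 large]]] := sum_euler_prod_lower_bound_large.
have [Bsmall Bsmall_gt0 small] := sum_euler_prod_lower_bound_small expo x0.
exists (Num.min Blarge Bsmall); first by rewrite lt_min Blarge_gt0.
move=> A X f etap etam N N2 densp densm f_sign signX modulus_le.
have [lnN_large|/ltW lnN_small] := leP x0 (ln N).
  apply: le_trans (large A X f etap etam N N2 lnN_large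
    densp densm f_sign signX modulus_le).
  by rewrite !ler_wpM2r ?powR_ge0 // ge_min lexx.
apply: le_trans (small A X f N N2 lnN_small f_sign modulus_le).
by rewrite !ler_wpM2r ?powR_ge0 // ge_min lexx orbT.
Qed.

End LowerBound.

Lemma ler_scale_powR {R : realType} (K C N : R) : 2 <= N ->
  K * N `^ C <= N `^ (C + ln (`|K| + 1) / ln 2).
Proof.
move=> N2; have N_gt0 : 0 < N by lra.
have K1_gt0 : 0 < `|K| + 1 by rewrite ltr_wpDl.
apply: le_trans (_ : (`|K| + 1) * N `^ C <= _).
  by rewrite ler_wpM2r ?powR_ge0 // (le_trans (ler_norm K)) // lerDl.
rewrite -{1}[`|K| + 1]lnK ?posrE // !powR_gt0E // -expRD ler_expR mulrDl addrC lerD2l.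
by rewrite mulrAC ler_pdivlMr ?ln2_gt0 // ler_wpM2l ?ln2_le_ln // ln_ge0 // lerDr.
Qed.

Lemma size_gt0_of_ln_ge {R : realType} {A : Type} (X : seq A) (b N : R) :
  0 < b -> 2 <= N -> b * ln N <= ln (size X)%:R -> (0 < size X)%N.
Proof.
move=> b0 N2; apply: contraTT; rewrite -eqn0Ngt => /eqP ->.
by rewrite (ln0 (lexx 0)) -ltNge mulr_gt0 // ln_ge2_gt0.
Qed.

Theorem theorem5p2 (R : realType)
  (alpha xi cp cm Mp Mm C : R)
  (K0 a1 a2 Kp Km Ep Em KC : R) :
  1 < alpha -> 0 < xi -> 0 < cp -> 0 < cm -> 0 < C -> 0 < a1 ->
  exists B1 B2 : R, 0 < B1 /\ 0 < B2 /\
  forall (A : eqType) (ht : A -> R) (AN : R -> seq A)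
         (f : nat -> A -> int) (etap etam : nat -> R),
    ~ finite_set [set: A] ->
    (forall N, uniq (AN N)) ->
    (forall N x, (x \in AN N) = (ht x <= N)) ->
    (forall N, 2 <= N ->
       a1 * ln N <= ln (size (AN N))%:R <= a2 * ln N) ->
    (forall p x, prime p -> f p x \in [:: -1; 0; 1]%R) ->
    mult01 etap -> mult01 etam ->
    (forall N, 2 <= N -> forall qm qp : nat,
       squarefree qm -> squarefree qp -> coprime qm qp ->
       ((qm * qp)%N%:R <= N `^ (xi / 2)) ->
       `| (count_sign (AN N) f qm qp)%:R / (size (AN N))%:R
          - etam qm * etap qp | <= K0 * N `^ (- xi)) ->
    (forall p, prime p -> etap p <= Kp / p%:R) ->
    (forall p, prime p -> etam p <= Km / p%:R) ->
    (forall N, 2 <= N ->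
       `| sum_primes_le N etap - (cp * ln (ln N) + Mp) | <= Ep / ln N) ->
    (forall N, 2 <= N ->
       `| sum_primes_le N etam - (cm * ln (ln N) + Mm) | <= Em / ln N) ->
    (forall N, 2 <= N -> forall x, x \in AN N -> forall n,
       partial_supp_prod f x n <= KC * N `^ C) ->
    forall N, 2 <= N ->
      B1 * (size (AN N))%:R
         * (ln N) `^ ((alpha - 1) * cp - (1 - alpha^-1) * cm)
        <= \sum_(x <- AN N) euler_weight alpha f x
      /\ \sum_(x <- AN N) euler_weight alpha f x
        <= B2 * (size (AN N))%:R * (ln N) `^ ((alpha - 1) * cp).
Proof.
move=> alpha_gt1 xi_gt0 cp_gt0 cm_gt0 C_gt0 a1_gt0; set C' := C + ln (`|KC| + 1) / ln 2.
have C'_gt0 : 0 < C' by rewrite ltr_wpDr // divr_ge0 ?ln_ge0 ?lerDr // ltW // ln2_gt0.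
have [B1 B1_gt0 lower] := sum_euler_prod_lower_bound Mp Mm Ep Em Kp Km
  alpha_gt1 xi_gt0 (ltW cp_gt0) (ltW cm_gt0) (normr_ge0 K0) C'_gt0.
have [B2 B2_gt0 upper] := sum_euler_prod_upper_bound Mp Ep
  alpha_gt1 xi_gt0 (ltW cp_gt0) (normr_ge0 K0) (ltW C'_gt0).
exists B1, B2; do 2!split=> //.
move=> A ht AN f etap etam _ _ _ size_ge f_sign multp multm count_le etapK etamK.
move=> etapM etamM supp_le N N2.
have densp : sieve_density cp Mp Ep Kp etap.
  by split=> // [|n n2]; [exact: mult01_prob|rewrite -sum_primes_leE etapM].
have densm : sieve_density cm Mm Em Km etam.
  by split=> // [|n n2]; [exact: mult01_prob|rewrite -sum_primes_leE etamM].
have size_gt0 := size_gt0_of_ln_ge a1_gt0 N2 (proj1 (andP (size_ge N N2))).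
have signN : sign_equidistributed (AN N) f etap etam (`|K0| * N `^ (- xi)) (N `^ (xi / 2)).
  apply: count_sign_equidistributed => // qm qp sqm sqp coprime_q qN.
  apply: le_trans (count_le N N2 qm qp sqm sqp coprime_q qN) _.
  by rewrite ler_wpM2r ?powR_ge0 // ler_norm.
have suppN : supp_bounded (AN N) f (N `^ C').
  by move=> x xN n; apply: le_trans (supp_le N N2 x xN n) (ler_scale_powR _ _ N2).
rewrite (sum_euler_weightE alpha suppN); split.
  by apply: lower N2 densp densm f_sign signN _ => x /suppN/sign_modulus_le; apply.
have [etap_prob etap_mertens _] := densp.
apply: upper N2 etap_prob etap_mertens f_sign (plus_equidistributed signN) _ => x.
by move/suppN/sign_modulus_le; apply.
Qed.
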